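(* Given $q\in(1,\infty)$, $C\ge 1$ and $\alpha,\eta\in(0,1)$, there is $\varepsilon=\varepsilon(q,C,\alpha,\eta)>0$ such that the following holds: if $\nu\in\mathcal{P}(\mathbb{R})$ is Ahlfors $\alpha$-regular with constant $C$, then $$D(\mu\ast\nu,q)>D(\mu,q)+\varepsilon$$ for any measure $\mu\in\mathcal{P}(\mathbb{R})$ with $D(\mu,q)<1-\eta$.
   Context: $\mathcal{P}(\mathbb{R})$ denotes the family of compactly supported Borel probability measures on $\mathbb{R}$. Logarithms are to base $2$. For $m\in\mathbb{N}$, $\mathcal{D}_m=\{[k2^{-m},(k+1)2^{-m}):k\in\mathbb{Z}\}$. For $1<q<\infty$ and $\nu\in\mathcal{P}(\mathbb{R})$, the $L^q$ dimension of $\nu$ is $$D(\nu,q)=\liminf_{m\to\infty}\frac{-\log\sum_{Q\in\mathcal{D}_m}\nu(Q)^q}{(q-1)m}.$$ The convolution $\mu\ast\nu$ is the push-forward of $\mu\times\nu$ under $(x,y)\mapsto x+y$. $B(x,r)$ denotes the closed ball $[x-r,x+r]$. A measure $\nu\in\mathcal{P}(\mathbb{R})$ is Ahlfors $\alpha$-regular with constant $C\ge1$ if $C^{-1}r^{\alpha}\le\nu(B(x,r))\le Cr^{\alpha}$ for all $x\in\operatorname{spt}\nu$ and $r\in(0,1)$. *)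

(* Defs.v *)
From HB Require Import structures.
From mathcomp Require Import all_boot all_order all_algebra.
From mathcomp Require Import all_classical all_reals all_analysis.
From mathcomp Require Import measurable_realfun.

Set Implicit Arguments.
Unset Strict Implicit.
Unset Printing Implicit Defensive.

Import Order.TTheory GRing.Theory Num.Theory.
Import numFieldNormedType.Exports.

Local Open Scope classical_set_scope.
Local Open Scope ring_scope.

Notation borel_probability R := (probability (measurableTypeR R) R).

Section defs.
Context {R : realType}.
Implicit Types (mu nu : borel_probability R).

Definition spt nu : set R :=
  [set x | forall r : R, 0 < r -> (0 < nu (ball x r))%E].

Definition compactly_supported nu : Prop := compact (spt nu).

Definition dyadic (m : nat) (k : int) : set R :=
  `[k%:~R / 2 ^+ m, (k + 1)%:~R / 2 ^+ m[%classic.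

Definition log2 (x : R) : R := ln x / ln 2.

(* Since 1 < q and nu is a probability measure, the sum is in ]0, 1], so that
   fine loses no information; the junk value at m = 0 does not affect the
   liminf. *)
Definition lq_dim nu (q : R) : \bar R :=
  limn_einf (fun m : nat =>
    (- log2 (fine (\esum_(k in [set: int]) poweR (nu (dyadic m k)) q)) /
       ((q - 1) * m%:R))%:E).

Definition cball (x r : R) : set R := `[x - r, x + r]%classic.

Definition ahlfors_regular (alpha C : R) nu : Prop :=
  forall x r : R, spt nu x -> 0 < r < 1 ->
    ((C^-1 * r `^ alpha)%:E <= nu (cball x r) <= (C * r `^ alpha)%:E)%E.

Definition addp (p : measurableTypeR R * measurableTypeR R) :
  measurableTypeR R := p.1 + p.2.

Lemma measurable_addp : measurable_fun [set: _] addp.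
Proof. exact: measurable_funD measurable_fst measurable_snd. Qed.

HB.instance Definition _ := isMeasurableFun.Build _ _ _ _ addp measurable_addp.

Definition convolution mu nu : borel_probability R :=
  distribution (mu \x nu)%E addp.

End defs.

(* Main.v *)
Require Import Defs.
From mathcomp Require Import all_boot all_order all_algebra.
From mathcomp Require Import all_classical all_reals all_analysis.
From mathcomp Require Import measurable_realfun.
From mathcomp Require Import ring lra zify.

Set Implicit Arguments.
Unset Strict Implicit.
Unset Printing Implicit Defensive.

Import Order.TTheory GRing.Theory Num.Theory.
Import numFieldNormedType.Exports.

Local Open Scope ring_scope.

(** Seen at scale 2^-m, a compactly supported measure is a polynomial with
    nonnegative coefficients, the coefficient of X^i being the mass of the i-th
    dyadic interval, and up to neighbouring cells a convolution is a product of
    polynomials.  Let P stand for nu and f for mu.  The theorem says that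
    multiplication by P lowers the sum of the q-th powers of the coefficients of
    f by a factor 2^(-g m), with g depending on q, C, alpha and eta only, unless
    f is already almost as spread out as possible.  Three ideas carry the proof.

    High powers of P are almost flat ([power_decay]): for some n that depends on
    C, alpha and eta, but not on m, the coefficients of P^n are at most
    N 2^(-m (1 - eta)).  By regularity nu splits into nested cells of sizes M^j
    (in units of 2^-m), and no cell keeps more than half of its mass in an
    interval of length 2 M^j / H, where H depends only on C and alpha
    ([piece_node]).  Let 2 M^2 independent points be drawn from cells of size
    M^j.  Their sum falls in a given window of length M^j / H with probability
    O(1/M), by a Littlewood-Offord argument ([packed_prod]), and it lives at
    distance O(M^(j+1)) from its mean, by Chebyshev.  So adding it to a
    measure that is flat at scale M^(j+1) / H gives one that is flat at scale
    M^j / H, with a loss that does not depend on M ([spread_step]).  When s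
    consecutive scales are treated in this way, with different points for
    different scales, n = 2 s M^2 points go down a factor M^s in scale and lose
    kappa^s, which is small against M^(s eta) once M is large.  After that the
    same n points serve again: given the cells of size M^(s i) in which they lie,
    they are n independent points in smaller cells ([coef_decay]).

    Flat powers force a gain in l^2 ([energy_decay]).  Multiplication by P
    is a normal operator on l^2, so the squared norms of f, P f, P^2 f, and so on
    form a log-convex sequence.  If P kept most of the norm of the
    indicator of a set, P^n would also keep a fair part of it, and this is
    impossible for a set of at most 2^(m (1 - eta / 2)) points when P^n is flat.

    Level sets give all exponents q ([psum_flat]).  Cut f into the O(m) dyadic
    level sets of its values.  The sets on which f exceeds 2^(-m (1 - eta / 2))
    are small enough for the l^2 gain, which is transferred to l^q by comparing
    x^q with x and x^2; the remaining part of f has a small l^q norm by itself,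
    and D(mu, q) < 1 - eta makes that norm negligible.  The polynomial factor in
    m disappears in the lower limit. *)

(** * Finite measures as polynomials *)

Section FiniteMeasures.
Variable R : realFieldType.
Implicit Types (p q u v : {poly R}) (phi psi : nat -> R).

Definition nonneg p := forall i, 0 <= p`_i.

(** Not normalised: the mass of p is p.[1]. *)
Definition expect p phi := \sum_(i < size p) p`_i * phi i.

Lemma expect_wide n p phi :
  (size p <= n)%N -> expect p phi = \sum_(i < n) p`_i * phi i.
Proof.
move=> le; rewrite /expect (big_ord_widen _ (fun i => p`_i * phi i) le).
rewrite big_mkcond; apply: eq_bigr => i _.
by case: ltnP => // h; rewrite nth_default // mul0r.
Qed.

Lemma expectD p q phi : expect (p + q) phi = expect p phi + expect q phi.
Proof.
pose n := maxn (size p) (size q).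
rewrite (@expect_wide n p) ?leq_maxl // (@expect_wide n q) ?leq_maxr //.
rewrite (@expect_wide n) ?size_polyD // -big_split.
by apply: eq_bigr => i _; rewrite coefD mulrDl.
Qed.

Lemma expectZ a p phi : expect (a *: p) phi = a * expect p phi.
Proof.
rewrite (@expect_wide (size p)) ?size_scale_leq // mulr_sumr.
by apply: eq_bigr => i _; rewrite coefZ mulrA.
Qed.

Lemma expect0 phi : expect 0 phi = 0.
Proof. by rewrite /expect size_poly0 big_ord0. Qed.

Lemma expect_sum I (r : seq I) (P : pred I) (F : I -> {poly R}) phi :
  expect (\sum_(i <- r | P i) F i) phi = \sum_(i <- r | P i) expect (F i) phi.
Proof. exact: (big_morph (expect^~ phi) (fun p q => expectD p q phi) (expect0 phi)). Qed.

Lemma expectXn n phi : expect 'X^n phi = phi n.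
Proof.
rewrite /expect size_polyXn big_ord_recr /= coefXn eqxx mul1r big1 ?add0r //.
by move=> i _; rewrite coefXn ltn_eqF ?mul0r.
Qed.

Lemma poly_sum p : p = \sum_(i < size p) p`_i *: 'X^i.
Proof. by rewrite -poly_def coefK. Qed.

(** The product of polynomials is the law of the sum of independent points. *)
Lemma expectM p q phi :
  expect (p * q) phi = expect p (fun i => expect q (fun j => phi (i + j)%N)).
Proof.
transitivity (expect ((\sum_(i < size p) p`_i *: 'X^i) *
                      (\sum_(j < size q) q`_j *: 'X^j)) phi).
  by rewrite -!poly_sum.
rewrite mulr_suml expect_sum; apply: eq_bigr => i _.
rewrite -scalerAl expectZ; congr (_ * _).
rewrite mulr_sumr expect_sum; apply: eq_bigr => j _.
by rewrite -scalerAr expectZ -exprD expectXn.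
Qed.

Lemma eq_expect p phi psi : phi =1 psi -> expect p phi = expect p psi.
Proof. by move=> h; apply: eq_bigr => i _; rewrite h. Qed.

Lemma expect_addf p phi psi :
  expect p (fun i => phi i + psi i) = expect p phi + expect p psi.
Proof. by rewrite -big_split; apply: eq_bigr => i _; rewrite mulrDr. Qed.

Lemma expect_mulf p a phi : expect p (fun i => a * phi i) = a * expect p phi.
Proof. by rewrite mulr_sumr; apply: eq_bigr => i _; rewrite mulrCA. Qed.

Lemma expect_sumf I (r : seq I) p (F : I -> nat -> R) :
  expect p (fun i => \sum_(k <- r) F k i) = \sum_(k <- r) expect p (F k).
Proof.
by rewrite exchange_big; apply: eq_bigr => i _; rewrite mulr_sumr.
Qed.

Lemma expect_exchange p q (W : nat -> nat -> R) :
  expect q (fun j => expect p (W^~ j)) = expect p (fun i => expect q (W i)).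
Proof.
rewrite /expect; under eq_bigr do rewrite mulr_sumr.
rewrite exchange_big; apply: eq_bigr => i _; rewrite mulr_sumr.
by apply: eq_bigr => j _; rewrite mulrCA.
Qed.

Lemma expect_cst p a : expect p (fun=> a) = p.[1] * a.
Proof.
rewrite horner_coef mulr_suml; apply: eq_bigr => i _.
by rewrite expr1n mulr1.
Qed.

Lemma expect_le p phi psi :
  nonneg p -> (forall i, p`_i != 0 -> phi i <= psi i) ->
  expect p phi <= expect p psi.
Proof.
move=> p0 h; apply: ler_sum => i _.
have [->|ne] := eqVneq p`_i 0; first by rewrite !mul0r.
by rewrite ler_wpM2l ?h.
Qed.

Lemma expect_le_cst p a phi : nonneg p -> p.[1] = 1 ->
  (forall i, p`_i != 0 -> phi i <= a) -> expect p phi <= a.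
Proof.
by move=> p0 p1 /(expect_le p0)/le_trans; apply; rewrite expect_cst p1 mul1r.
Qed.

Lemma expect_ge0 p phi : nonneg p -> (forall i, 0 <= phi i) -> 0 <= expect p phi.
Proof. by move=> p0 h; apply: sumr_ge0 => i _; rewrite mulr_ge0. Qed.

Lemma coef_expect p x : p`_x = expect p (fun i => (i == x)%:R).
Proof.
rewrite (@expect_wide (maxn (size p) x.+1)) ?leq_maxl //.
rewrite (bigD1 (Ordinal (leq_maxr (size p) x.+1 : x < _)%N)) //= eqxx mulr1.
by rewrite big1 ?addr0 // => i /negbTE h; rewrite -val_eqE /= in h; rewrite h mulr0.
Qed.

Lemma mass_ge0 p : nonneg p -> 0 <= p.[1].
Proof. by move=> h; rewrite -[p.[1]]mulr1 -(expect_cst p 1) expect_ge0. Qed.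

Lemma coef_le_mass p x : nonneg p -> p`_x <= p.[1].
Proof.
move=> h; rewrite coef_expect -[leRHS]mulr1 -expect_cst expect_le // => i _.
by case: eqP.
Qed.

Lemma nonnegM p q : nonneg p -> nonneg q -> nonneg (p * q).
Proof. by move=> hp hq i; rewrite coefM sumr_ge0 // => j _; rewrite mulr_ge0. Qed.

Lemma nonneg1 : nonneg (1 : {poly R}).
Proof. by move=> i; rewrite coef1; case: eqP. Qed.

Lemma nonnegZ a p : 0 <= a -> nonneg p -> nonneg (a *: p).
Proof. by move=> a0 h i; rewrite coefZ mulr_ge0. Qed.

Lemma nonneg_prod (cs : seq {poly R}) :
  (forall q, q \in cs -> nonneg q) -> nonneg (\prod_(q <- cs) q).
Proof.
elim: cs => [|q cs IH] h; first by rewrite big_nil; exact: nonneg1.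
rewrite big_cons; apply: nonnegM; first by apply: h; rewrite mem_head.
by apply: IH => r hr; apply: h; rewrite inE hr orbT.
Qed.

Lemma nonneg_mass0 p : nonneg p -> p.[1] = 0 -> p = 0.
Proof.
move=> h h0; apply/polyP => i; rewrite coef0; apply/eqP.
by rewrite eq_le h -{2}h0 coef_le_mass.
Qed.

Definition win (lam : nat) (x : int) (i : nat) : R :=
  ((x <= i%:Z) && (i%:Z < x + lam%:Z))%:R.

Lemma win_ge0 lam x i : 0 <= win lam x i. Proof. by rewrite /win; case: (_ && _). Qed.
Lemma win_le1 lam x i : win lam x i <= 1. Proof. by rewrite /win; case: (_ && _). Qed.

Definition window lam p x := expect p (win lam x).

Lemma window_ge0 lam p x : nonneg p -> 0 <= window lam p x.
Proof. by move=> h; apply: expect_ge0 => // i; exact: win_ge0. Qed.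

Lemma window_le_mass lam p x : nonneg p -> window lam p x <= p.[1].
Proof.
move=> h; rewrite -[leRHS]mulr1 -expect_cst expect_le // => i _; exact: win_le1.
Qed.

Lemma windowM lam p q x :
  window lam (p * q) x = expect q (fun j => window lam p (x - j%:Z)).
Proof.
rewrite /window mulrC expectM; apply: eq_expect => j; apply: eq_expect => i.
by rewrite /win; congr (_%:R); lia.
Qed.

(** Left end points of disjoint half-open intervals of length lam. *)
Definition spaced (lam : nat) (s : seq int) := sorted (fun a b => a + lam%:Z <= b) s.

(** Controlling k disjoint windows at once, and not only one, is what makes
    the induction on the number of summands work. *)
Definition packed lam (g : nat -> R) p :=
  forall s, spaced lam s -> \sum_(x <- s) window lam p x <= g (size s).

Lemma spaced_disjoint lam s i : spaced lam s -> \sum_(x <- s) win lam x i <= 1.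
Proof.
elim: s => [|x s IH] hs; first by rewrite big_nil.
have tr : transitive (fun a b : int => a + lam%:Z <= b) by move=> a b c; lia.
have hs' : spaced lam s by apply: path_sorted hs.
rewrite big_cons [win lam x i]/win; case: (boolP (_ && _)) => [/andP[h1 h2]|_];
  last by rewrite add0r IH.
rewrite big_seq big1 ?addr0 // => y ys.
have /allP/(_ y ys) hy := order_path_min tr (hs : path _ x s).
by rewrite /win; case: (boolP (_ && _)) => //; lia.
Qed.

Lemma packed_single lam p : nonneg p -> p.[1] <= 1 ->
  packed lam (fun k => (0 < k)%:R) p.
Proof.
move=> h h1 [|x s] hs; first by rewrite big_nil.
rewrite -expect_sumf /=; apply: le_trans h1.
rewrite -[leRHS]mulr1 -expect_cst expect_le // => i _.
exact: spaced_disjoint hs.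
Qed.

Lemma spaced_shift lam s (y : int) :
  spaced lam s -> spaced lam [seq x - y | x <- s].
Proof.
rewrite /spaced sorted_map; apply: sub_sorted => a b /=; lia.
Qed.

(** Shift k disjoint windows by y and by y'.  If the shifts differ by lam or
    more, the leftmost of the windows shifted further left can be given to the
    other family, which yields k + 1 and k - 1 disjoint windows: the exchange of
    Kleitman's proof of the Littlewood-Offord inequality. *)
Lemma packed_pair lam g p x s (y y' : nat) : packed lam g p ->
  spaced lam (x :: s) -> (y + lam <= y')%N ->
  \sum_(z <- x :: s) window lam p (z - y%:Z) +
  \sum_(z <- x :: s) window lam p (z - y'%:Z) <= g (size s).+2 + g (size s).
Proof.
move=> hp hs hy.
have h1 : spaced lam [seq z - y%:Z | z <- x :: s] by exact: spaced_shift.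
have h2 : spaced lam [seq z - y'%:Z | z <- s].
  by apply: spaced_shift; apply: path_sorted hs.
have h3 : spaced lam (x - y'%:Z :: [seq z - y%:Z | z <- x :: s]).
  by move: h1; rewrite /spaced /= => ->; rewrite andbT; lia.
have := lerD (hp _ h3) (hp _ h2).
by rewrite !big_cons !big_map /= !size_map; lra.
Qed.

(** One step of the lazy walk with increments -1, 0, 1 of weights 1/4, 1/2,
    1/4, killed at 0. *)
Definition lazy_step (g : nat -> R) k :=
  if k is k'.+1 then g k / 2 + (g k.+1 + g k') / 4 else 0.

(** Draw two independent points y, y' from q.  They are lam-separated with
    probability at least 1/2, and then [packed_pair] applies; otherwise the trivial
    bound is used.  Concavity of g makes the separated case the better one. *)
Lemma packed_step lam g p q : packed lam g p ->
  (forall k, g k + g k.+2 <= 2 * g k.+1) ->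
  nonneg p -> nonneg q -> q.[1] = 1 ->
  (forall x, window (lam + lam) q x <= 1 / 2) ->
  packed lam (lazy_step g) (p * q).
Proof.
move=> hp gc p0 q0 q1 hq [|x s] hs; first by rewrite big_nil.
under eq_bigr => z _ do rewrite windowM.
rewrite -expect_sumf; set psi := (fun y : nat => _ : R).
(* Average over an independent copy y' of y. *)
have -> : expect q psi =
    expect q (fun y => expect q (fun y' => (psi y + psi y') / 2)).
  under [RHS]eq_expect => y.
    under eq_expect => y' do rewrite mulrC mulrDr.
    rewrite expect_addf expect_cst q1 mul1r expect_mulf; over.
  by rewrite expect_addf expect_cst q1 mul1r expect_mulf; field.
set k := size s.
pose nr (y y' : nat) : R := win (lam + lam) (y%:Z - lam%:Z) y'.
have le y y' : (psi y + psi y') / 2 <=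
    (g k.+2 + g k) / 2 + (g k.+1 - (g k.+2 + g k) / 2) * nr y y'.
  rewrite /nr /win; case: (boolP (_ && _)) => h; last first.
    rewrite mulr0 addr0 ler_pM2r ?invr_gt0 ?ltr0n //.
    have [h'|h'] : (y + lam <= y')%N \/ (y' + lam <= y)%N by lia.
      exact: packed_pair hs h'.
    by rewrite addrC; exact: packed_pair hs h'.
  rewrite mulr1 [leRHS]addrC subrK.
  have b (z : nat) : psi z <= g k.+1.
    have := hp _ (@spaced_shift lam _ z%:Z hs).
    by rewrite big_map size_map.
  by have := b y; have := b y'; lra.
have P y : expect q (nr y) <= 1 / 2 by exact: hq.
apply: (le_trans (y := expect q (fun y : nat => (g k.+2 + g k) / 2 +
   (g k.+1 - (g k.+2 + g k) / 2) * (1 / 2)))).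
  apply: expect_le => // y _.
  apply: le_trans (expect_le q0 (fun y' _ => le y y')) _.
  rewrite expect_addf expect_cst q1 mul1r expect_mulf lerD2l ler_wpM2l //.
  by have := gc k; lra.
rewrite expect_cst q1 mul1r /=; lra.
Qed.

(** The sum of the k largest binomial coefficients of order 2 K + 1 on the upper
    half, over 4^K: the orbit of the indicator of k > 0 under [lazy_step]. *)
Definition binom_mass (K k : nat) : R :=
  (\sum_(i < k) 'C(K.*2.+1, K.+1 + i)%N)%:R / 4 ^+ K.

Lemma binom_mass0 K : binom_mass K 0 = 0. Proof. by rewrite /binom_mass big_ord0 mul0r. Qed.

Lemma binom_massS K k :
  binom_mass K k.+1 = binom_mass K k + 'C(K.*2.+1, K.+1 + k)%:R / 4 ^+ K.
Proof. by rewrite /binom_mass big_ord_recr natrD mulrDl. Qed.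

Lemma bin_decr K k : ('C(K.*2.+1, K.+1 + k.+1) <= 'C(K.*2.+1, K.+1 + k))%N.
Proof.
have := mul_bin_left K.*2.+1 (K.+1 + k); rewrite addnS => h.
rewrite -(@leq_pmul2l (K.+1 + k).+1) // h leq_mul2r; apply/orP; right; lia.
Qed.

Lemma binom_mass_concave K k : binom_mass K k + binom_mass K k.+2 <= 2 * binom_mass K k.+1.
Proof.
rewrite !binom_massS.
have : 'C(K.*2.+1, K.+1 + k.+1)%:R / 4 ^+ K <= 'C(K.*2.+1, K.+1 + k)%:R / 4 ^+ K :> R.
  by rewrite ler_wpM2r ?invr_ge0 ?exprn_ge0 ?ler_nat ?bin_decr.
lra.
Qed.

Lemma binom_mass_step K k : lazy_step (binom_mass K) k = binom_mass K.+1 k.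
Proof.
have E4 : 4 ^+ K != 0 :> R by rewrite expf_neq0 ?pnatr_eq0.
case: k => [|k]; first by rewrite binom_mass0.
elim: k => [|k IH].
  rewrite /= !binom_massS !binom_mass0 !add0r !addn0 addn1 exprS.
  have -> : 'C(K.+1.*2.+1, K.+2) = ('C(K.*2.+1, K.+2) + 3 * 'C(K.*2.+1, K.+1))%N.
    rewrite doubleS !binS.
    have -> : 'C(K.*2.+1, K) = 'C(K.*2.+1, K.+1).
      by rewrite -bin_sub; [congr 'C(_, _)|]; lia.
    by rewrite binS; lia.
  rewrite natrD natrM; field => //.
rewrite [RHS]binom_massS -IH /= !binom_massS exprS.
have -> : 'C(K.+1.*2.+1, K.+2 + k.+1) =
    ('C(K.*2.+1, K.+1 + k.+2) + 2 * 'C(K.*2.+1, K.+1 + k.+1) + 'C(K.*2.+1, K.+1 + k))%N.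
  by rewrite doubleS !addnS !addSn !binS; lia.
rewrite !natrD ?natrM; field => //.
Qed.

Lemma eq_packed lam g g' p : g =1 g' -> packed lam g p -> packed lam g' p.
Proof. by move=> e h s /h; rewrite e. Qed.

(** The Littlewood-Offord inequality for points that need not be two-valued:
    each factor is only asked not to concentrate on an interval of length 2 lam. *)
Lemma packed_prod lam (cs : seq {poly R}) :
  (forall q, q \in cs -> [/\ nonneg q, q.[1] = 1 &
     forall x, window (lam + lam) q x <= 1 / 2]) ->
  packed lam (binom_mass (size cs)) (\prod_(q <- cs) q).
Proof.
elim: cs => [|q cs IH] h.
  rewrite big_nil; apply: (@eq_packed _ (fun k => (0 < k)%:R)).
    move=> [|k]; first by rewrite binom_mass0.
    by rewrite /binom_mass big_ord_recl big1 ?addn0 ?expr0 ?divr1 //.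
  apply: packed_single; [exact: nonneg1 | by rewrite hornerE].
rewrite big_cons mulrC; apply: eq_packed (binom_mass_step _) _.
have h' r : r \in cs -> _ := fun hr => h r (@mem_behead _ (q :: cs) r hr).
have [q0 q1 hq] := h _ (mem_head _ _).
apply: packed_step => //; first exact: IH.
  by move=> k; exact: binom_mass_concave.
by apply: nonneg_prod => r /h' [].
Qed.

(** The classical induction: (2 K + 1)(2 K + 3) <= (2 K + 2)^2. *)
Lemma central_bin K : ('C(K.*2, K) ^ 2 * K.*2.+1 <= 16 ^ K)%N.
Proof.
elim: K => // K IH.
have e : (K.+1 * 'C(K.+1.*2, K.+1) = 2 * K.*2.+1 * 'C(K.*2, K))%N.
  rewrite doubleS -mul_bin_diag /=.
  have := mul_bin_diag K.*2.+1 K; rewrite -(@bin_sub K.*2.+1 K.+1) /=; last lia.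
  have -> : (K.*2.+1 - K.+1 = K)%N by lia.
  by rewrite -mulnA => ->; rewrite mulnA -doubleS -mul2n.
rewrite -(@leq_pmul2l (K.+1 ^ 2)) ?expn_gt0 // mulnA -expnMn e.
rewrite (expnS 16) doubleS; move: IH; set c := 'C(_, _); set t := (16 ^ K)%N => IH.
apply: (leq_trans (n := (4 * K.*2.+1 * K.*2.+3) * t)%N).
  rewrite (_ : (_ * _)%N = 4 * K.*2.+1 * K.*2.+3 * (c ^ 2 * K.*2.+1))%N; last by ring.
  by rewrite leq_mul2l IH orbT.
by rewrite mulnA leq_mul2r; apply/orP; right; nia.
Qed.

Lemma binom_mass1_le K M : (0 < M)%N -> (M ^ 2 <= K)%N -> binom_mass K 1 <= 2 / M%:R.
Proof.
move=> M0 hK.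
rewrite binom_massS binom_mass0 add0r addn0.
have e : (K.+1 * 'C(K.*2.+1, K.+1) = K.*2.+1 * 'C(K.*2, K))%N by rewrite -mul_bin_diag.
have h : ('C(K.*2.+1, K.+1) * M <= 2 * 4 ^ K)%N.
  have : ((K.+1 * ('C(K.*2.+1, K.+1) * M)) ^ 2 <= (K.+1 * (2 * 4 ^ K)) ^ 2)%N.
    rewrite mulnA e.
    have := central_bin K.
    have -> : (16 ^ K = (4 ^ K) ^ 2)%N by rewrite -expnM mulnC expnM.
    set c := 'C(_, _); set t := (4 ^ K)%N => IH.
    rewrite (_ : (_ ^ 2) = K.*2.+1 * M ^ 2 * (c ^ 2 * K.*2.+1))%N; last by ring.
    rewrite (_ : ((_ * (_ * _)) ^ 2) = 4 * K.+1 ^ 2 * t ^ 2)%N; last by ring.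
    by apply: leq_mul IH; nia.
  by rewrite leq_exp2r // leq_pmul2l.
rewrite ler_pdivrMr ?exprn_gt0 ?ltr0n // mulrAC ler_pdivlMr ?ltr0n //.
by rewrite -natrX -!natrM ler_nat.
Qed.

End FiniteMeasures.

(** * Sums of spread-out points fill a window evenly *)

Section Spread.
Variable R : realFieldType.
Implicit Types (p q u v : {poly R}) (phi psi : nat -> R).

(** A bounded increasing function whose increments dominate 1 / (1 + u^2),
    so that sums of the latter telescope. *)
Definition sigm (t : R) := t / (1 + `|t|).

Lemma sigm_le1 (t : R) : `|sigm t| <= 1.
Proof.
have h : 0 < 1 + `|t| by rewrite ltr_wpDr ?normr_ge0.
rewrite /sigm normrM normfV (gtr0_norm h) ler_pdivrMr // mul1r.
by rewrite lerDr ler01.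
Qed.

Lemma sigm_incr (t u : R) : t <= u -> u <= t + 1 ->
  (1 + u ^+ 2)^-1 <= 4 * (sigm (t + 1) - sigm t).
Proof.
have pos (t0 u0 : R) : 0 <= t0 -> t0 <= u0 ->
    (1 + u0 ^+ 2)^-1 <= 4 * (sigm (t0 + 1) - sigm t0).
  move=> t0_ge0 le; rewrite /sigm !ger0_norm ?addr_ge0 //.
  have -> : 4 * ((t0 + 1) / (1 + (t0 + 1)) - t0 / (1 + t0)) =
      4 / ((1 + t0) * (2 + t0)).
    by field; apply/andP; split; lra.
  have h1 : 0 < (1 + t0) * (2 + t0) by rewrite mulr_gt0 //; lra.
  have h2 : 0 < 1 + u0 ^+ 2 by nra.
  have h3 : t0 ^+ 2 <= u0 ^+ 2 by nra.
  rewrite -[leLHS]mul1r ler_pdivlMr // mulrAC ler_pdivrMr // mul1r.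
  by have := sqr_ge0 (t0 - 1 / 2); nra.
move=> h1 h2.
have [t0|t0] := leP 0 t; first exact: pos.
have sN (x : R) : sigm (- x) = - sigm x by rewrite /sigm normrN mulNr.
have [t1|t1] := leP t (-1).
  have := pos (- (t + 1)) (- u); rewrite sqrrN => /(_ _ _).
  have -> : - (t + 1) + 1 = - t by ring.
  by rewrite !sN => h; apply: le_trans (h _ _) _; lra.
have h3 : (1 + u ^+ 2)^-1 <= 1 by rewrite invf_le1; nra.
apply: le_trans h3 _.
rewrite /sigm (ltr0_norm t0) ger0_norm; last by lra.
have -> : 4 * ((t + 1) / (1 + (t + 1)) - t / (1 - t)) =
  4 * (1 - 2 * t * (t + 1) - t - t ^+ 2 + t ^+ 2 - 1 + 1 + t) / ((2 + t) * (1 - t)).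
  by field; apply/andP; split; lra.
have h4 : 0 < (2 + t) * (1 - t) by rewrite mulr_gt0 //; lra.
by rewrite ler_pdivlMr //; nra.
Qed.

(** A measure that is flat at scale d gives mass O(B) to the kernel
    1 / (1 + u^2) of width d: each interval of length d
    contributes at most B times an increment of [sigm]. *)
Lemma expect_cauchy (d : nat) p (B c : R) : (0 < d)%N -> nonneg p ->
  (forall x, window d p x <= B) ->
  expect p (fun y => (1 + ((y%:R - c) / d%:R) ^+ 2)^-1) <= 8 * B.
Proof.
move=> d0 p0 hB.
have B0 : 0 <= B by apply: le_trans (hB 0); exact: window_ge0.
have dR : 0 < d%:R :> R by rewrite ltr0n.
pose t (k : nat) : R := k%:R - c / d%:R.
pose n := size p.
apply: (le_trans (y := expect p (fun y => \sum_(k < n)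
   4 * (sigm (t k + 1) - sigm (t k)) * win R d (k%:Z * d%:Z) y))).
  apply: expect_le => // y py.
  have ny : (y < n)%N by case: ltnP py => // h; rewrite nth_default ?eqxx.
  have nk : (y %/ d < n)%N by apply: leq_ltn_trans ny; exact: leq_div.
  have inc k : 0 <= 4 * (sigm (t k + 1) - sigm (t k)).
    apply: le_trans (sigm_incr (lexx (t k)) _); last by rewrite lerDl.
    by rewrite invr_ge0 addr_ge0 // sqr_ge0.
  rewrite (bigD1 (Ordinal nk)) //= ler_wpDr //.
    by apply: sumr_ge0 => k _; rewrite mulr_ge0 // win_ge0.
  have yE := divn_eq y d; have ym := ltn_pmod y d0.
  have -> : win R d ((y %/ d)%:Z * d%:Z) y = 1 by rewrite /win; case: (boolP (_ && _)) => //; lia.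
  rewrite mulr1; apply: sigm_incr; rewrite /t mulrBl ?lerD2r.
    by rewrite ler_pdivlMr // -natrM ler_nat; lia.
  rewrite [leRHS]addrAC lerD2r ler_pdivrMr // natr1 -natrM ler_nat.
  by rewrite {1}yE mulSnr leq_add2l ltnW.
rewrite expect_sumf.
apply: (le_trans (y := \sum_(k < n) 4 * (sigm (t k.+1) - sigm (t k)) * B)).
  apply: ler_sum => k _; rewrite expect_mulf.
  have -> : t k.+1 = t k + 1 by rewrite /t -natr1 addrAC.
  rewrite ler_wpM2l ?hB //.
  apply: le_trans (sigm_incr (lexx (t k)) _); last by rewrite lerDl.
  by rewrite invr_ge0 addr_ge0 // sqr_ge0.
rewrite -mulr_suml -mulr_sumr -(big_mkord xpredT (fun k => sigm (t k.+1) - sigm (t k))).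
rewrite telescope_sumr // ler_wpM2r //.
have := sigm_le1 (t n); have := sigm_le1 (t 0%N).
rewrite !ler_norml; lra.
Qed.

Definition centred (m V : R) p :=
  expect p (fun i => i%:R - m) = 0 /\ expect p (fun i => (i%:R - m) ^+ 2) <= V.

Lemma centredM m m' V V' p q : p.[1] = 1 -> q.[1] = 1 ->
  centred m V p -> centred m' V' q -> centred (m + m') (V + V') (p * q).
Proof.
move=> p1 q1 [hm hV] [hm' hV']; split.
  rewrite expectM -{}hm; apply: eq_expect => i.
  transitivity (expect q (fun j => (i%:R - m) + (j%:R - m'))).
    by apply: eq_expect => j; rewrite natrD; ring.
  by rewrite expect_addf expect_cst q1 mul1r hm' addr0.
rewrite expectM; apply: le_trans (lerD hV hV'); rewrite le_eqVlt; apply/orP; left.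
apply/eqP; transitivity (expect p (fun i => (i%:R - m) ^+ 2 +
    expect q (fun j => (j%:R - m') ^+ 2))); last first.
  by rewrite expect_addf expect_cst p1 mul1r.
apply: eq_expect => i.
transitivity (expect q (fun j => (i%:R - m) ^+ 2 + (j%:R - m') ^+ 2 +
   2 * (i%:R - m) * (j%:R - m'))).
  by apply: eq_expect => j; rewrite natrD; ring.
by rewrite 2!expect_addf (expect_mulf q (2 * _)) hm' mulr0 addr0 expect_cst q1 mul1r.
Qed.

(** The law of a point in a cell of radius r that is spread out at scale lam; only
    the ratio of r to lam matters later. *)
Definition node lam (r : R) q : Prop :=
  [/\ nonneg q, q.[1] = 1, forall x, window (lam + lam) q x <= 1 / 2 &
     exists a : R, forall i, q`_i != 0 -> `|i%:R - a| <= r].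

(** The variance is at most the second moment about any point. *)
Lemma node_centred lam r q : node lam r q -> exists m, centred m (r ^+ 2) q.
Proof.
move=> [q0 q1 _ [a ha]]; pose m := expect q (fun i => i%:R).
have hm : expect q (fun i : nat => i%:R - m) = 0.
  by rewrite expect_addf expect_cst q1 mul1r subrr.
exists m; split=> //.
apply: (le_trans (y := expect q (fun i => (i%:R - a) ^+ 2))).
  have -> : expect q (fun i : nat => (i%:R - a) ^+ 2) =
      expect q (fun i : nat => (i%:R - m) ^+ 2 + (m - a) ^+ 2 + 2 * (m - a) * (i%:R - m)).
    by apply: eq_expect => i; ring.
  rewrite 2!expect_addf (expect_mulf q (2 * _)) hm mulr0 addr0 expect_cst q1 mul1r.
  by rewrite lerDl sqr_ge0.
apply: expect_le_cst => // i /ha h.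
have r0 : 0 <= r by apply: le_trans h.
by rewrite -real_normK ?num_real // ler_sqr ?nnegrE.
Qed.

Lemma nodes_centred lam r (rs : seq {poly R}) :
  (forall q, q \in rs -> node lam r q) ->
  (\prod_(q <- rs) q).[1] = 1 /\
  exists m, centred m ((size rs)%:R * r ^+ 2) (\prod_(q <- rs) q).
Proof.
elim: rs => [|q rs IH] h.
  rewrite big_nil hornerE; split=> //; exists 0; split.
    by rewrite /expect size_poly1 big_ord1 subrr mulr0.
  by rewrite /expect size_poly1 big_ord1 /= subrr expr0n /= mulr0 mul0r.
have [|p1 [m hm]] := IH; first by move=> u hu; apply: h; rewrite inE hu orbT.
have hq := h q (mem_head _ _); have [_ q1 _ _] := hq.
have [m' hm'] := node_centred hq.
rewrite big_cons hornerM q1 p1 mulr1; split=> //.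
exists (m' + m); have := centredM q1 p1 hm' hm.
by rewrite /= -natr1 mulrDl mul1r addrC [r ^+ 2 + _]addrC [m + m']addrC.
Qed.

(** A sum of two independent points far from its mean has one of the two
    summands far from its own mean, which costs a Chebyshev factor; the other
    summand is still free to bring the anticoncentration factor a.  Both factors
    are obtained at once by bounding the window times
    1 + ((z - m - m') / d)^2 pointwise. *)
Lemma two_halves (lam d : nat) p p' (a m m' V : R) z :
  (0 < d)%N -> (lam <= d)%N -> nonneg p -> nonneg p' -> p.[1] = 1 -> p'.[1] = 1 ->
  (forall x, window lam p x <= a) -> (forall x, window lam p' x <= a) ->
  centred m V p -> centred m' V p' ->
  window lam (p * p') z <=
    a * (3 + 8 * V / d%:R ^+ 2) * (1 + ((z%:~R - (m + m')) / d%:R) ^+ 2)^-1.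
Proof.
move=> d0 ld p0 p'0 p1 p'1 ha ha' [_ hV] [_ hV'].
have dR : 0 < d%:R :> R by rewrite ltr0n.
set c := 1 + _.
have c0 : 0 < c by rewrite /c ltr_wpDr ?sqr_ge0.
rewrite -ler_pdivrMr ?invr_gt0 // invrK /window expectM mulrC -expect_mulf.
pose e := d%:R^-1 ^+ 2 : R.
have e0 : 0 <= e by rewrite /e sqr_ge0.
have e1 : d%:R ^+ 2 * e = 1 by rewrite /e -exprMn mulfV ?expr1n // gt_eqF.
have wa i : expect p' (fun j => win R lam z (i + j)) <= a.
  have -> : expect p' (fun j => win R lam z (i + j)) = window lam p' (z - i%:Z).
    by apply: eq_expect => j; rewrite /win; congr (_%:R); lia.
  exact: ha'.
have wa' j : expect p (fun i => win R lam z (i + j)) <= a.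
  have -> : expect p (fun i => win R lam z (i + j)) = window lam p (z - j%:Z).
    by apply: eq_expect => i; rewrite /win; congr (_%:R); lia.
  exact: ha.
have a0 : 0 <= a by apply: le_trans (ha 0); exact: window_ge0.
pose W i j := win R lam z (i + j).
apply: (le_trans (y := expect p (fun i => expect p' (fun j =>
   3 * W i j + 4 * e * (i%:R - m) ^+ 2 * W i j + 4 * e * (j%:R - m') ^+ 2 * W i j)))).
  apply: expect_le => // i _; rewrite -expect_mulf; apply: expect_le => // j _.
  rewrite -/(W i j) /W /win; case: (boolP (_ && _)) => [/andP[h1 h2]|_]; last first.
    by rewrite !mulr0 !addr0.
  rewrite !mulr1 /c expr_div_n.
  have h1' : z%:~R <= i%:R + j%:R :> R.
    by move: h1; rewrite -(ler_int R) -pmulrn natrD.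
  have h2' : i%:R + j%:R <= z%:~R + d%:R :> R.
    have : ((i + j)%:Z)%:~R <= (z + d%:Z)%:~R :> R by rewrite ler_int; lia.
    by rewrite intrD -!pmulrn natrD.
  rewrite -exprVn -/e.
  set z' := z%:~R in h1' h2' *; set i' := i%:R in h1' h2' *.
  set j' := j%:R in h1' h2' *.
  have : (z' - (m + m')) ^+ 2 <= 2 * d%:R ^+ 2 + 4 * (i' - m) ^+ 2 + 4 * (j' - m') ^+ 2.
    set x := i' - m; set y := j' - m'; pose s := i' + j' - z'.
    have -> : z' - (m + m') = x + y - s by rewrite /x /y /s; ring.
    have : s ^+ 2 <= d%:R ^+ 2.
      by rewrite ler_sqr ?nnegrE /s; [lra|lra|exact: ltW].
    have := sqr_ge0 (x + y + s); have := sqr_ge0 (x - y); nra.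
  move=> /(ler_wpM2r e0); move: e1; set D := d%:R ^+ 2.
  set S := (z' - _) ^+ 2; set X := (i' - m) ^+ 2; set Y := (j' - m') ^+ 2; lra.
have -> : expect p (fun i => expect p' (fun j => 3 * W i j +
   4 * e * (i%:R - m) ^+ 2 * W i j + 4 * e * (j%:R - m') ^+ 2 * W i j)) =
   3 * expect p (fun i => expect p' (W i)) +
   4 * e * expect p (fun i => (i%:R - m) ^+ 2 * expect p' (W i)) +
   4 * e * expect p' (fun j => (j%:R - m') ^+ 2 * expect p (W^~ j)).
  have -> : expect p' (fun j => (j%:R - m') ^+ 2 * expect p (W^~ j)) =
      expect p (fun i => expect p' (fun j => (j%:R - m') ^+ 2 * W i j)).
    transitivity (expect p' (fun j => expect p (fun i => (j%:R - m') ^+ 2 * W i j))).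
      by apply: eq_expect => j; rewrite expect_mulf.
    exact: expect_exchange.
  rewrite -!expect_mulf -!expect_addf; apply: eq_expect => i.
  by rewrite !expect_addf mulrA -!expect_mulf -!expect_addf; apply: eq_expect => j; ring.
have S1 : expect p (fun i => expect p' (W i)) <= a.
  by apply: expect_le_cst => // i _; exact: wa.
have S2 : expect p (fun i => (i%:R - m) ^+ 2 * expect p' (W i)) <= V * a.
  apply: (le_trans (y := expect p (fun i => a * (i%:R - m) ^+ 2))).
    by apply: expect_le => // i _; rewrite mulrC ler_wpM2r ?sqr_ge0 //; exact: wa.
  by rewrite expect_mulf mulrC ler_wpM2r.
have S3 : expect p' (fun i => (i%:R - m') ^+ 2 * expect p (W^~ i)) <= V * a.
  apply: (le_trans (y := expect p' (fun i => a * (i%:R - m') ^+ 2))).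
    by apply: expect_le => // i _; rewrite mulrC ler_wpM2r ?sqr_ge0 //; exact: wa'.
  by rewrite expect_mulf mulrC ler_wpM2r.
rewrite -exprVn -/e.
have := ler_wpM2l e0 S2; have := ler_wpM2l e0 S3; nra.
Qed.

(** The windows of a sum of 2 M^2 nodes have mass O(1/M) with a quadratic decay
    away from the mean on the scale M lam, by [two_halves]; a measure that is flat
    at scale M lam averages this profile to O(1/M) by [expect_cauchy].  The
    constant depends on the ratio H between radius and separation, not on M. *)
Lemma spread_step (lam M : nat) (H B : R) p (rs rs' : seq {poly R}) z :
  (0 < lam)%N -> (0 < M)%N -> nonneg p -> (forall x, window (M * lam) p x <= B) ->
  size rs = (M ^ 2)%N -> size rs' = (M ^ 2)%N ->
  (forall q, q \in rs -> node lam (3 * H * lam%:R) q) ->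
  (forall q, q \in rs' -> node lam (3 * H * lam%:R) q) ->
  window lam (p * (\prod_(q <- rs) q * \prod_(q <- rs') q)) z <=
    B * ((48 + 1152 * H ^+ 2) / M%:R).
Proof.
move=> l0 M0 p0 hB sz sz' hrs hrs'.
have MR : 0 < M%:R :> R by rewrite ltr0n.
have lR : 0 < lam%:R :> R by rewrite ltr0n.
have LO (cs : seq {poly R}) : size cs = (M ^ 2)%N ->
    (forall q, q \in cs -> node lam (3 * H * lam%:R) q) ->
    nonneg (\prod_(q <- cs) q) /\ forall x, window lam (\prod_(q <- cs) q) x <= 2 / M%:R.
  move=> szc hc; split; first by apply: nonneg_prod => q /hc[].
  move=> x; apply: le_trans (binom_mass1_le R M0 (leqnn _)); rewrite -szc.
  have := @packed_prod R lam cs _ [:: x]; rewrite big_seq1; apply=> //.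
  by move=> q /hc[].
have [n0 w0] := LO _ sz hrs; have [n0' w0'] := LO _ sz' hrs'.
have [m0 [m hm]] := nodes_centred hrs; have [m0' [m' hm']] := nodes_centred hrs'.
rewrite sz in hm; rewrite sz' in hm'.
set P := \prod_(q <- rs) q in n0 w0 m0 hm *.
set P' := \prod_(q <- rs') q in n0' w0' m0' hm' *.
have d0 : (0 < M * lam)%N by rewrite muln_gt0 M0.
have ld : (lam <= M * lam)%N by rewrite leq_pmull.
set V := _ * _ in hm hm'.
rewrite mulrC windowM.
have key (y : nat) := @two_halves lam (M * lam) P P' _ m m' V (z - y%:Z)
  d0 ld n0 n0' m0 m0' w0 w0' hm hm'.
apply: le_trans (expect_le p0 (fun y _ => key y)) _.
rewrite expect_mulf.
have -> : expect p (fun i : nat =>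
     (1 + (((z - i%:Z)%:~R - (m + m')) / (M * lam)%:R) ^+ 2)^-1) =
   expect p (fun y : nat => (1 + ((y%:R - (z%:~R - (m + m'))) / (M * lam)%:R) ^+ 2)^-1).
  apply: eq_expect => y; congr (1 + _)^-1; rewrite !expr_div_n; congr (_ / _).
  by rewrite intrB -pmulrn; ring.
have := expect_cauchy (z%:~R - (m + m')) d0 p0 hB.
have -> : 2 / M%:R * (3 + 8 * V / (M * lam)%:R ^+ 2) = (6 + 144 * H ^+ 2) / M%:R.
  rewrite /V natrX natrM; field; rewrite ?pnatr_eq0 -?lt0n ?M0 ?l0 //.
have h0 : 0 <= (6 + 144 * H ^+ 2) / M%:R.
  by rewrite divr_ge0 ?(ltW MR) // addr_ge0 // mulr_ge0 // sqr_ge0.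
move=> /(ler_wpM2l h0) h; apply: le_trans h _.
rewrite le_eqVlt; apply/orP; left; apply/eqP; field.
by rewrite gt_eqF.
Qed.

End Spread.

(** * Flatness propagates down a tree of cells *)

Section Tree.
Variable R : realFieldType.
Implicit Types (p q u v : {poly R}) (phi psi : nat -> R).

Definition mixture (N : {poly R} -> Prop) q :=
  exists n (F : 'I_n -> {poly R}), q = \sum_i F i /\ forall i, N (F i).

(** Products are multilinear, so a linear inequality between functionals of a
    product may be checked on products of pieces, that is, conditionally on the
    pieces that contain the points. *)
Lemma mixture_prod (N : {poly R} -> Prop) k (D : {poly R} -> R) :
  {morph D : u v / u + v} ->
  (forall rs, size rs = k -> (forall q, q \in rs -> N q) ->
     0 <= D (\prod_(q <- rs) q)) ->
  forall cs, size cs = k -> (forall q, q \in cs -> mixture N q) ->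
     0 <= D (\prod_(q <- cs) q).
Proof.
elim: k D => [|k IH] D Dadd hD [|c cs] //= => [_ _|[szc] hc].
  by apply: (hD [::]).
have [n [F [cE hF]]] := hc c (mem_head _ _).
have D0 : D 0 = 0 by apply: (addrI (D 0)); rewrite -Dadd !addr0.
rewrite big_cons cE mulr_suml (big_morph D Dadd D0); apply: sumr_ge0 => i _.
pose Di u := D (F i * u).
apply: (IH Di) szc _.
- by move=> u v; rewrite /Di mulrDr Dadd.
- move=> rs szr hrs; have := hD (F i :: rs); rewrite big_cons /= szr.
  by apply=> // q; rewrite inE => /predU1P[->|/hrs].
- by move=> q hq; apply: hc; rewrite inE hq orbT.
Qed.

(** The case c = 0 allows pieces of mass zero, which have no normalisation. *)
Definition scaled_node lam (r : R) q :=
  exists c q', [/\ 0 <= c, q = c *: q' & c = 0 \/ node lam r q'].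

Lemma scaled_nodes lam r (cs : seq {poly R}) :
  (forall q, q \in cs -> scaled_node lam r q) ->
  \prod_(q <- cs) q = 0 \/ exists c rs, [/\ 0 <= c, size rs = size cs,
     forall q, q \in rs -> node lam r q & \prod_(q <- cs) q = c *: \prod_(q <- rs) q].
Proof.
elim: cs => [_|q cs IH h].
  by right; exists 1, [::]; split=> //; rewrite scale1r.
rewrite big_cons.
have [c [q' [c0 -> [->|hq']]]] := h q (mem_head _ _).
  by left; rewrite scale0r mul0r.
have [|->|[c' [rs [c'0 sz hrs ->]]]] := IH.
- by move=> u hu; apply: h; rewrite inE hu orbT.
- by left; rewrite mulr0.
right; exists (c * c'), (q' :: rs); split.
- exact: mulr_ge0.
- by rewrite /= sz.
- by move=> u; rewrite inE => /predU1P[->|/hrs].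
- by rewrite big_cons -scalerAl -scalerAr scalerA.
Qed.

Definition spread_cst (H : R) := 48 + 1152 * H ^+ 2.

Lemma spread_cst_ge4 H : 4 <= spread_cst H.
Proof.
apply: (@le_trans _ _ 48); first by rewrite ler_nat.
by rewrite lerDl mulr_ge0 ?ler0n ?sqr_ge0.
Qed.

Lemma spread_cst_gt0 H : 0 < spread_cst H.
Proof. by apply: lt_le_trans (spread_cst_ge4 H). Qed.

Lemma spread_scaled (lam M : nat) (H B : R) p (cs : seq {poly R}) z :
  (0 < lam)%N -> (0 < M)%N -> nonneg p -> (forall x, window (M * lam) p x <= B) ->
  size cs = (M ^ 2 + M ^ 2)%N ->
  (forall q, q \in cs -> scaled_node lam (3 * H * lam%:R) q) ->
  window lam (p * \prod_(q <- cs) q) z <=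
    B * (spread_cst H / M%:R) * (\prod_(q <- cs) q).[1].
Proof.
move=> l0 M0 p0 hB sz /scaled_nodes [->|[c [rs [c0 szr hrs ->]]]].
  by rewrite mulr0 horner0 mulr0 /window expect0.
rewrite hornerZ -scalerAr /window expectZ.
have [-> _] := nodes_centred hrs.
rewrite mulr1 mulrC ler_wpM2r //.
rewrite -(cat_take_drop (M ^ 2) rs) big_cat; apply: spread_step => //.
- by rewrite size_takel // szr sz leq_addr.
- by rewrite size_drop szr sz addnK.
- by move=> q hq; apply: hrs; apply: mem_take hq.
- by move=> q hq; apply: hrs; apply: mem_drop hq.
Qed.

Definition in_ball (D : nat) q := exists a : int, forall i, q`_i != 0 -> `|i%:Z - a| <= D%:Z.

Lemma in_ball_prod D (cs : seq {poly R}) :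
  (forall q, q \in cs -> in_ball D q) -> in_ball (size cs * D) (\prod_(q <- cs) q).
Proof.
elim: cs => [|q cs IH] h.
  by exists 0 => -[|i]; rewrite big_nil coef1 ?eqxx.
have [|a ha] := IH; first by move=> u hu; apply: h; rewrite inE hu orbT.
have [b hb] := h q (mem_head _ _).
exists (b + a) => i; rewrite big_cons coefM => ne.
have [j /andP[hj hk]] : exists j : 'I_i.+1,
    (q`_j != 0) && ((\prod_(q <- cs) q)`_(i - j) != 0).
  apply/existsP; apply: contraNT ne => /existsPn hn.
  rewrite big1 // => j _; apply/eqP; rewrite mulf_eq0.
  by have := hn j; rewrite negb_and !negbK.
have := hb _ hj; have := ha _ hk; have := ltn_ord j.
rewrite /= mulSn; lia.
Qed.

(** The structure of the pieces of a measure at scales M^j, kept apart from its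
    construction: [PP j q] says that q is a piece of level j.  Only the levels
    from 1 to J are required to be spread out, since the pieces of level 0 will be
    point masses. *)
Record tree (M H J : nat) (PP : nat -> {poly R} -> Prop) : Prop := Tree {
  tree_ge0 : forall j q, PP j q -> nonneg q;
  tree_mix : forall j j' q, (j <= j')%N -> PP j' q -> mixture (PP j) q;
  tree_node : forall j q, (0 < j <= J)%N -> PP j q ->
    scaled_node (M ^ j %/ H) (3 * H%:R * (M ^ j %/ H)%:R) q;
  tree_ball : forall j q, PP j q -> in_ball (3 * M ^ j) q }.

Variables (M H J : nat) (PP : nat -> {poly R} -> Prop).
Hypotheses (HM : (H %| M)%N) (H0 : (0 < H)%N) (M0 : (0 < M)%N).
Hypothesis T : tree M H J PP.

Let lam j := (M ^ j %/ H)%N.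

Let lamS j : (0 < j)%N -> lam j.+1 = (M * lam j)%N.
Proof.
move=> j0; rewrite /lam expnS muln_divA //.
by case: j j0 => // j _; rewrite expnS dvdn_mulr.
Qed.

Let lam_gt0 j : (0 < j)%N -> (0 < lam j)%N.
Proof.
case: j => // j _; rewrite divn_gt0 //; apply: dvdn_leq; first by rewrite expn_gt0 M0.
by rewrite expnS dvdn_mulr.
Qed.

Let kap : R := spread_cst H%:R / M%:R.

Let kap_ge0 : 0 <= kap.
Proof. by apply: divr_ge0; [exact: ltW (spread_cst_gt0 _) | exact: ler0n]. Qed.

(** One application of [spread_step] per level, each to 2 M^2 factors of its own:
    the factors of the group are split into pieces of level j, while the product
    of the previous groups is flat at scale M^(j + 1) / H. *)
Lemma windows_shrink L s t cs x : (L + s <= J)%N -> (t <= s)%N ->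
  size cs = (t * (M ^ 2 + M ^ 2))%N -> (forall q, q \in cs -> PP (L + s) q) ->
  window (lam (L + s - t).+1) (\prod_(q <- cs) q) x <=
    kap ^+ t * (\prod_(q <- cs) q).[1].
Proof.
move=> LsJ; elim: t cs x => [|t IH] cs x ts szc hc.
  rewrite expr0 mul1r window_le_mass //.
  by apply: nonneg_prod => q /hc; exact: (tree_ge0 T).
set n := (M ^ 2 + M ^ 2)%N in szc.
have hc1 q : q \in take n cs -> PP (L + s) q by move=> /mem_take /hc.
have hc2 q : q \in drop n cs -> PP (L + s) q by move=> /mem_drop /hc.
rewrite -(cat_take_drop n cs) big_cat.
set rho := \prod_(q <- drop n cs) q.
set j := (L + s - t.+1).+1.
have jE : j = (L + s - t)%N by rewrite /j; lia.
have j1 : (0 < j <= J)%N by rewrite /j; lia.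
have rho0 : nonneg rho by apply: nonneg_prod => q /hc2; exact: (tree_ge0 T).
have hB y : window (M * lam j) rho y <= kap ^+ t * rho.[1].
  rewrite -lamS // jE; apply: IH => //; first exact: ltnW.
  by rewrite size_drop szc mulSn addKn.
pose D u := kap ^+ t.+1 * rho.[1] * u.[1] - window (lam j) (rho * u) x.
have : 0 <= D (\prod_(q <- take n cs) q); last first.
  by rewrite /D subr_ge0 mulrC hornerM; congr (_ <= _); ring.
apply: (@mixture_prod (PP j) n).
- by move=> u v; rewrite /D hornerD mulrDr mulrDr /window expectD; ring.
- move=> rs szr hrs; rewrite /D subr_ge0.
  have -> : kap ^+ t.+1 * rho.[1] = kap ^+ t * rho.[1] * kap by rewrite exprS; ring.
  apply: spread_scaled => //; first by case/andP: j1 => /lam_gt0.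
  by move=> q /hrs; exact: (tree_node T).
- by rewrite size_takel // szc mulSn leq_addr.
- by move=> q /hc1; apply: (tree_mix T) => //; rewrite jE leq_subr.
Qed.

Definition ball_ind (D : nat) (x y : nat) : R := (`|y%:Z - x%:Z| <= D%:Z)%R%:R.

Lemma ball_windows D K l p x (B : R) : nonneg p -> (0 < l)%N -> (D.*2 < K * l)%N ->
  (forall z, window l p z <= B) -> expect p (ball_ind D x) <= K%:R * B.
Proof.
move=> p0 l0 hK hB.
apply: (le_trans (y := \sum_(k < K) window l p (x%:Z - D%:Z + (k * l)%:Z))); last first.
  apply: (le_trans (ler_sum _ (fun k _ => hB _))).
  by rewrite sumr_const card_ord mulr_natl.
rewrite -expect_sumf; apply: expect_le => // y _.
rewrite /ball_ind; case: (boolP (`|y%:Z - x%:Z| <= D%:Z)) => h; last first.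
  by apply: sumr_ge0 => k _; exact: win_ge0.
pose e := absz (y%:Z - (x%:Z - D%:Z))%R.
have eE : e%:Z = y%:Z - (x%:Z - D%:Z) by rewrite /e; lia.
have ek : (e %/ l < K)%N by rewrite ltn_divLR //; lia.
rewrite (bigD1 (Ordinal ek)) //= ler_wpDr //.
  by apply: sumr_ge0 => k _; exact: win_ge0.
have em := ltn_pmod e l0; have eD := divn_eq e l.
by rewrite /win; case: (boolP (_ && _)) => //; lia.
Qed.

Variable s : nat.
Hypothesis s0 : (0 < s)%N.
Let n := (s * (M ^ 2 + M ^ 2))%N.
Let Theta : R := (25 * M * s * H)%:R * kap ^+ s.

Let Theta_ge0 : 0 <= Theta.
Proof. by rewrite mulr_ge0 // exprn_ge0. Qed.

(** Induction on the number I of blocks of s levels.  Split the factors into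
    pieces of level s I.  A product of such pieces is supported in a ball of radius
    3 n M^(s I), so its coefficient at x vanishes unless that ball contains x;
    the pieces that count therefore lie in a ball around x, whose mass is bounded
    by [windows_shrink], and their coefficients are bounded by induction. *)
Lemma coef_decay I cs x : (s * I <= J)%N ->
  size cs = n -> (forall q, q \in cs -> PP (s * I) q) ->
  (\prod_(q <- cs) q)`_x <= Theta ^+ I * (\prod_(q <- cs) q).[1].
Proof.
elim: I cs x => [|I IH] cs x sJ szc hc.
  rewrite expr0 mul1r coef_le_mass //.
  by apply: nonneg_prod => q /hc; exact: (tree_ge0 T).
have sJ' : (s * I <= J)%N by apply: leq_trans sJ; rewrite leq_mul2l leqnSn orbT.
pose L := (s * I)%N; pose W := (n * (3 * M ^ L))%N.
pose D u := Theta ^+ I * expect u (ball_ind W.*2 x) - u`_x.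
have : 0 <= D (\prod_(q <- cs) q).
  apply: (@mixture_prod (PP L) n) => //.
  - by move=> u v; rewrite /D coefD expectD; ring.
  - move=> rs szr hrs; rewrite /D subr_ge0.
    set u := \prod_(q <- rs) q.
    have u0 : nonneg u by apply: nonneg_prod => q /hrs; exact: (tree_ge0 T).
    have [->|ne] := eqVneq u`_x 0.
      rewrite mulr_ge0 ?exprn_ge0 // expect_ge0 // => y; exact: ler0n.
    apply: le_trans (IH rs x sJ' szr hrs) _; rewrite ler_wpM2l ?exprn_ge0 //.
    rewrite -[leLHS]mulr1 -expect_cst; apply: expect_le => // y hy.
    have [|a ha] := @in_ball_prod (3 * M ^ L) rs.
      by move=> q /hrs; exact: (tree_ball T).
    have := ha _ hy; have := ha _ ne; rewrite szr -/W /ball_ind.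
    by case: (boolP (`|y%:Z - x%:Z| <= _)) => //; lia.
  - by move=> q /hc; apply: (tree_mix T) => //; rewrite leq_mul2l leqnSn orbT.
rewrite /D subr_ge0 => /le_trans; apply.
rewrite exprSr -mulrA ler_wpM2l ?exprn_ge0 //.
have c0 : nonneg (\prod_(q <- cs) q) by apply: nonneg_prod => q /hc; exact: (tree_ge0 T).
rewrite /Theta -mulrA.
apply: (@ball_windows _ _ (lam L.+1)) => //; first exact: lam_gt0.
  have lamE : lam L.+1 = (M %/ H * M ^ L)%N by rewrite /lam expnS divn_mulAC.
  have [h hE] := dvdnP HM.
  have hE' : (M %/ H = h)%N by rewrite hE mulnK.
  have P : (0 < s * M ^ 2 * M ^ L)%N by rewrite !muln_gt0 s0 !expn_gt0 M0.
  rewrite lamE hE' (_ : (25 * M * s * H * _ = 25 * (s * M * (h * H) * M ^ L))%N); last by ring.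
  rewrite -hE /W /n -!mul2n (_ : (25 * _ = 25 * (s * M ^ 2 * M ^ L))%N); last by ring.
  rewrite (_ : (2 * _ = 24 * (s * M ^ 2 * M ^ L))%N); last by ring.
  by rewrite ltn_pmul2r.
move=> z.
have := @windows_shrink L s s cs z; rewrite addnK; apply=> //.
  by rewrite /L -mulnSr.
by move=> q /hc; rewrite /L -mulnSr.
Qed.

Lemma coef_power_decay I p x : (s * I <= J)%N -> mixture (PP (s * I)) p ->
  (p ^+ n)`_x <= Theta ^+ I * p.[1] ^+ n.
Proof.
move=> sJ hp.
pose D u := Theta ^+ I * u.[1] - u`_x.
have : 0 <= D (\prod_(q <- nseq n p) q).
  apply: (@mixture_prod (PP (s * I)) n).
  - by move=> u v; rewrite /D hornerD coefD; ring.
  - by move=> rs szr hrs; rewrite /D subr_ge0 coef_decay.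
  - by rewrite size_nseq.
  - by move=> q /nseqP[-> _].
by rewrite /D subr_ge0 big_nseq -[iter _ _ _]/(iter n ( *%R p) 1) iter_mulr_1 horner_exp.
Qed.

End Tree.

(** * The tree of cells of a regular measure *)

Section Cells.
Variable R : realFieldType.
Variables (p : {poly R}) (A : nat -> R) (C : R) (T M H J : nat).

(** Regularity at the scales between 1 and T, in units of the smallest cell;
    A r stands for the mass of a ball of radius r. *)
Record regular : Prop := Regular {
  regular_ge0 : nonneg p;
  regular_lower : forall x r, p`_x != 0 -> (0 < r < T)%N ->
    C^-1 * A r <= expect p (ball_ind R r x);
  regular_upper : forall z r, (0 < r < T)%N -> window r p z <= C * A r }.

Hypothesis reg : regular.
Hypothesis C1 : 0 < C.
Hypothesis A2 : forall r, A (2 * r)%N <= 2 * A r.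
Hypothesis AH : forall r, 12 * C ^+ 2 * A (r + r)%N <= A (H * r)%N.
Hypotheses (HM : (H %| M)%N) (M2 : (2 %| M)%N) (M12 : (12 <= M)%N) (H3 : (3 <= H)%N).
Hypothesis MJ : (M ^ J <= T)%N.

Definition class_mass (lab : nat -> nat) (b : nat) :=
  expect p (fun x => (lab x %/ M == b)%N%:R).

Definition heavy lab j b := (6 * C)^-1 * A (M ^ j.+1) <= class_mass lab b.

(** A light interval that meets the support has a heavy neighbour, by
    [label_heavy]; the last branch is reached only when that is b - 1. *)
Definition merge lab j b :=
  if heavy lab j b then b else if heavy lab j b.+1 then b.+1 else b.-1.

(** Cells are built from the finest scale up, so that they are nested by
    construction: the label of level j + 1 depends on the label of level j only.
    Cutting from the top would leave light pieces at the ends of the cells. *)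
Fixpoint label j : nat -> nat :=
  if j is j'.+1 then fun x => merge (label j') j' (label j' x %/ M)%N else id.

Let M0 : (0 < M)%N. Proof. by apply: leq_trans M12. Qed.

(** Merging moves a label by at most 1 and taking the quotient by less than 1,
    so the distance d_j, in units of M^j, satisfies d_(j+1) <= 2 + d_j / M. *)
Lemma label_close j x : `|x%:Z - (M ^ j * label j x)%:Z| <= (3 * M ^ j)%:Z.
Proof.
elim: j => [|j IH]; first by rewrite /= expn0 mul1n subrr.
rewrite /=; set l := label j x in IH *.
have h : `|(merge (label j) j (l %/ M)%N)%:Z - (l %/ M)%N%:Z| <= 1.
  move: (l %/ M)%N => e; rewrite /merge.
  by case: ifP => _; [|case: ifP => _]; lia.
move: h; set b := merge _ _ _ => h.
have := divn_eq l M; have := ltn_pmod l M0; move: h.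
set e := (l %/ M)%N; set f := (l %% M)%N => h1 h2 h3.
move: IH; rewrite h3 expnS; set X := (M ^ j)%N => IH.
have q1 : (M * X * b <= M * X * (e + 1))%N by rewrite leq_mul2l; apply/orP; right; lia.
have q2 : (M * X * e <= M * X * (b + 1))%N by rewrite leq_mul2l; apply/orP; right; lia.
have q3 : (X * f <= X * M)%N by rewrite leq_mul2l (ltnW h2) orbT.
have q4 : (12 * X <= M * X)%N by rewrite leq_mul2r M12 orbT.
move: IH q1 q2 q3 q4; rewrite (_ : (X * (e * M + f) = M * X * e + X * f)%N); last by ring.
rewrite !mulnDr !muln1 (mulnC X M); lia.
Qed.

(** The ball of radius M^(j + 1) / 2 around a point of the support has the
    mass required by regularity and meets at most three consecutive grid intervals,
    so one of them is heavy. *)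
Lemma label_heavy j x : (j < J)%N -> p`_x != 0 -> heavy (label j) j (label j.+1 x).
Proof.
move=> jJ px; rewrite /=; set b := (label j x %/ M)%N.
have [m mE] := dvdnP M2.
pose X := (M ^ j)%N; pose r := (m * X)%N.
have X0 : (0 < X)%N by rewrite expn_gt0 M0.
have MX : (M ^ j.+1 = 2 * r)%N by rewrite expnS /r {1}mE /X; ring.
have r0 : (0 < r)%N by rewrite muln_gt0 X0 andbT; lia.
have rT : (0 < r < T)%N.
  rewrite r0 /=; apply: leq_trans MJ; apply: (@leq_trans (M ^ j.+1)).
    by rewrite MX; lia.
  by rewrite leq_exp2l //; apply: leq_trans M12.
have := regular_lower reg px rT.
(* M >= 12 leaves room for the two label errors 3 M^j next to r = M^(j+1)/2. *)
have near y : `|y%:Z - x%:Z| <= r%:Z ->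
    (label j y %/ M <= b.+1)%N && (b <= (label j y %/ M).+1)%N.
  move=> hy; have := label_close j x; have := label_close j y; rewrite -/X => h1 h2.
  set u := label j x in b h2 *; set v := label j y in h1 *.
  have h3 : (12 * X <= M * X)%N by rewrite leq_mul2r M12 orbT.
  have h4 : (M * X = 2 * r)%N by rewrite -MX expnS.
  have h5 : (X * v <= X * (u + M))%N by rewrite mulnDr (mulnC X M); lia.
  have h6 : (X * u <= X * (v + M))%N by rewrite mulnDr (mulnC X M); lia.
  rewrite leq_pmul2l // in h5; rewrite leq_pmul2l // in h6.
  have h7 := leq_div2r M h5; have h8 := leq_div2r M h6.
  by rewrite !divnDr ?dvdnn // !divnn M0 !addn1 in h7 h8; apply/andP.
(* For b = 0 the interval b.-1 is b itself, which only increases the bound. *)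
have le : expect p (ball_ind R r x) <=
   class_mass (label j) b + class_mass (label j) b.+1 + class_mass (label j) b.-1.
  rewrite /class_mass -!expect_addf; apply: expect_le; first exact: regular_ge0 reg.
  move=> y _; rewrite /ball_ind; case: (boolP (`|y%:Z - x%:Z| <= r%:Z)) => [/near|_].
    move=> /andP[h1 h2].
    have [_|n1] := eqVneq (label j y %/ M)%N b; first by rewrite -addrA lerDl addr_ge0.
    have [_|n2] := eqVneq (label j y %/ M)%N b.+1; first by rewrite addrAC lerDr addr_ge0.
    have [_|n3] := eqVneq (label j y %/ M)%N b.-1; first by rewrite lerDr addr_ge0.
    by exfalso; move: h1 h2 n1 n2 n3; move: (label j y %/ M)%N => e; lia.
  by rewrite !addr_ge0.
have a2 := A2 r; rewrite -MX in a2.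
have Ci : 0 < C^-1 by rewrite invr_gt0.
move=> h; have {le} h : C^-1 * (A (M ^ j.+1) / 2) <= _ := le_trans _ (le_trans h le).
have {}h : C^-1 * (A (M ^ j.+1) / 2) <= class_mass (label j) b +
   class_mass (label j) b.+1 + class_mass (label j) b.-1.
  by apply: h; rewrite ler_pM2l // ler_pdivrMr // mulrC.
rewrite /merge; case: ifPn => // h1; case: ifPn => // h2.
move: h1 h2; rewrite /heavy -!ltNge leNgt => h1 h2; apply/negP => h3.
move: h1 h2 h3 h; rewrite invfM; set a := A _; set c := C^-1; lra.
Qed.

Definition piece j (b : nat) : {poly R} :=
  \poly_(i < size p) (p`_i * (label j i == b)%:R).

Lemma coef_piece j b i : (piece j b)`_i = p`_i * (label j i == b)%:R.
Proof.
rewrite coef_poly; case: ltnP => // h; by rewrite nth_default // mul0r.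
Qed.

Lemma piece_ge0 j b : nonneg (piece j b).
Proof. by move=> i; rewrite coef_piece mulr_ge0 //; exact: regular_ge0 reg i. Qed.

Lemma expect_piece j b phi :
  expect (piece j b) phi = expect p (fun i => (label j i == b)%:R * phi i).
Proof.
rewrite (@expect_wide _ (size p)) ?size_poly //; apply: eq_bigr => i _.
by rewrite coef_piece mulrA.
Qed.

Definition cell j q := q = 0 \/ exists b : nat, q = piece j b.

Let Z j := (\max_(i < size p) label j i).+1.

Lemma piece_split j j' b : (j <= j')%N -> exists anc : nat -> nat,
  piece j' b = \sum_(c < Z j) (if anc c == b then piece j c else 0).
Proof.
move=> le; have [anc hanc] : exists anc, label j' =1 anc \o label j.
  rewrite -(subnK le); elim: (j' - j)%N => [|k [anc h]]; first by exists id.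
  by exists (fun y => merge (label (k + j)%N) (k + j)%N (anc y %/ M)%N) => x; rewrite /= h.
exists anc; apply/polyP => i; rewrite coef_piece coef_sum.
have [iz|iz] := ltnP i (size p); last first.
  rewrite nth_default // mul0r big1 // => c _.
  by case: ifP => _; rewrite ?coef0 // coef_piece nth_default // mul0r.
have lZ : (label j i < Z j)%N by rewrite ltnS (leq_bigmax (Ordinal iz)).
rewrite (bigD1 (Ordinal lZ)) //= big1 ?addr0 => [|c hc].
  by rewrite hanc /=; case: ifP => _; rewrite ?coef0 ?mulr0 // coef_piece eqxx.
case: ifP => _; rewrite ?coef0 // coef_piece.
by rewrite -val_eqE /= in hc; rewrite eq_sym (negbTE hc) mulr0.
Qed.

Lemma cells_whole j : mixture (cell j) p.
Proof.
exists (Z j), (fun c : 'I_(Z j) => piece j c); split; last by move=> c; right; exists c.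
apply/polyP => i; rewrite coef_sum.
have [iz|iz] := ltnP i (size p); last first.
  by rewrite nth_default // big1 // => c _; rewrite coef_piece nth_default // mul0r.
have lZ : (label j i < Z j)%N by rewrite ltnS (leq_bigmax (Ordinal iz)).
rewrite (bigD1 (Ordinal lZ)) //= big1 ?addr0 => [|c hc].
  by rewrite coef_piece eqxx mulr1.
by rewrite coef_piece; rewrite -val_eqE /= in hc; rewrite eq_sym (negbTE hc) mulr0.
Qed.

Lemma piece_ball j b : in_ball (3 * M ^ j) (piece j b).
Proof.
exists (M ^ j * b)%:Z => i; rewrite coef_piece.
case: (label j i =P b) => [<- _|_]; first exact: label_close.
by rewrite mulr0 eqxx.
Qed.

(** A piece of positive mass is heavy, while an interval of length 2 M^j / H has
    mass at most half of that by the upper regularity and the choice of H. *)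
Lemma piece_node j b : (0 < j <= J)%N ->
  scaled_node (M ^ j %/ H) (3 * H%:R * (M ^ j %/ H)%:R) (piece j b).
Proof.
move=> /andP[]; case: j => // j _ jJ; set q := piece _ _.
have q0 : nonneg q by exact: piece_ge0.
have [m0|m0] := eqVneq q.[1] 0.
  by exists 0, 0; split=> //; [rewrite scale0r; exact: nonneg_mass0|left].
have mp : 0 < q.[1] by rewrite lt_neqAle eq_sym m0 mass_ge0.
exists q.[1], (q.[1]^-1 *: q); split; [exact: ltW|by rewrite scalerA mulfV ?scale1r|right].
set l := (M ^ j.+1 %/ H)%N.
have lE : (H * l = M ^ j.+1)%N.
  by rewrite mulnC divnK // expnS dvdn_mulr.
have l0 : (0 < l)%N.
  have : (0 < H * l)%N by rewrite lE expn_gt0 M0.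
  by rewrite muln_gt0 => /andP[].
split.
- by apply: nonnegZ => //; rewrite invr_ge0 ltW.
- by rewrite hornerZ mulVf.
- move=> x; rewrite /window expectZ mulrC ler_pdivrMr //.
  have [i hi] : exists i, q`_i != 0.
    have [/existsP[i hi]|/existsPn hn] := boolP [exists i : 'I_(size q), q`_i != 0].
      by exists i.
    case/negP: m0; rewrite horner_coef big1 // => i _.
    by have := hn i; rewrite negbK => /eqP ->; rewrite mul0r.
  move: (hi); rewrite coef_piece mulf_eq0 negb_or => /andP[pi].
  case: (label j.+1 i =P b) => [lab _|_]; last by rewrite eqxx.
  have hb := label_heavy jJ pi; rewrite lab in hb.
  have mass : class_mass (label j) b <= q.[1].
    rewrite -[leRHS]mulr1 -expect_cst expect_piece; apply: expect_le.
      exact: regular_ge0 reg.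
    move=> y _; rewrite mulr1 /=; case: ((label j y %/ M)%N =P b) => [->|_]; last exact: ler0n.
    by rewrite /merge hb eqxx.
  have lT : (0 < l + l < T)%N.
    rewrite addn_gt0 l0 /=; apply: leq_trans MJ; apply: (@leq_trans (M ^ j.+1)).
      by rewrite -lE; nia.
    by rewrite leq_exp2l //; apply: leq_trans M12.
  have up := regular_upper reg x lT.
  have le : expect q (win R (l + l) x) <= window (l + l) p x.
    rewrite expect_piece; apply: expect_le; first exact: regular_ge0 reg.
    by move=> y _; case: (_ == _); rewrite ?mul1r // mul0r win_ge0.
  apply: le_trans le _; apply: le_trans up _.
  have ah := AH l; rewrite lE in ah.
  move: hb mass; rewrite /heavy; set a := A (M ^ j.+1) in ah *; set c := class_mass _ _.
  move=> h1 h2; have h3 := le_trans h1 h2.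
  rewrite ler_pdivrMl ?mulr_gt0 // in h3.
  rewrite -(ler_pM2l (_ : 0 < 12 * C)) ?mulr_gt0 //.
  by rewrite expr2 in ah; nra.
- have [a ha] := piece_ball j.+1 b; exists a%:~R => i.
  rewrite coefZ mulf_eq0 negb_or => /andP[_ /ha].
  rewrite -(ler_int R) intr_norm rmorphB /= => h; apply: le_trans h _.
  by rewrite -lE -pmulrn natrM (natrM _ H) mulrA.
Qed.

Lemma cell_tree : tree M H J cell.
Proof.
split.
- by move=> j q [->|[b ->]]; [move=> i; rewrite coef0|exact: piece_ge0].
- move=> j j' q le [->|[b ->]].
    by exists 0%N, (fun=> 0); rewrite big_ord0; split=> // -[].
  have [anc ->] := piece_split b le.
  exists (Z j), (fun c : 'I_(Z j) => if anc c == b then piece j c else 0); split=> // c.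
  by case: ifP => _; [right; exists c|left].
- move=> j q hj [->|[b ->]]; last exact: piece_node.
  by exists 0, 0; split=> //; [rewrite scale0r|left].
- move=> j q [->|[b ->]]; last exact: piece_ball.
  by exists 0 => i; rewrite coef0 eqxx.
Qed.

End Cells.

(** * Log-convexity of the l^2 norms of iterated products *)

Section Energy.
Variable R : realFieldType.
Implicit Types (p q f g u v P : {poly R}).

Definition ip u v := expect u (fun i => v`_i).

Lemma ip_wide n u v : (size u <= n)%N -> ip u v = \sum_(i < n) u`_i * v`_i.
Proof. exact: expect_wide. Qed.

Lemma ip_cauchy u v : ip u v ^+ 2 <= ip u u * ip v v.
Proof.
pose n := maxn (size u) (size v).
rewrite (@ip_wide n u v) ?leq_maxl // (@ip_wide n u u) ?leq_maxl //.
rewrite (@ip_wide n v v) ?leq_maxr //.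
set a := fun i : 'I_n => u`_i; set b := fun i : 'I_n => v`_i.
rewrite -subr_ge0.
have : 0 <= \sum_i \sum_j (a i * b j - a j * b i) ^+ 2.
  by apply: sumr_ge0 => i _; apply: sumr_ge0 => j _; exact: sqr_ge0.
have -> : \sum_i \sum_j (a i * b j - a j * b i) ^+ 2 =
   \sum_i \sum_j ((a i * a i) * (b j * b j)) +
   \sum_i \sum_j ((b i * b i) * (a j * a j)) -
   2 * \sum_i \sum_j ((a i * b i) * (a j * b j)).
  rewrite -big_split mulr_sumr -sumrB; apply: eq_bigr => i _.
  rewrite -big_split mulr_sumr -sumrB; apply: eq_bigr => j _ /=; ring.
have D (x y : 'I_n -> R) : \sum_i \sum_j x i * y j = (\sum_i x i) * (\sum_j y j).
  by rewrite mulr_suml; apply: eq_bigr => i _; rewrite mulr_sumr.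
rewrite (D (fun i => a i * a i) (fun i => b i * b i)).
rewrite (D (fun i => b i * b i) (fun i => a i * a i)).
rewrite (D (fun i => a i * b i) (fun i => a i * b i)); lra.
Qed.

(** The reflection X^D p(1/X), the adjoint of multiplication by p. *)
Definition revp D p : {poly R} := \sum_(i < D.+1) p`_i *: 'X^(D - i).

Lemma revpD D p q : revp D (p + q) = revp D p + revp D q.
Proof. by rewrite -big_split; apply: eq_bigr => i _; rewrite coefD scalerDl. Qed.

Lemma revpZ D a p : revp D (a *: p) = a *: revp D p.
Proof. by rewrite scaler_sumr; apply: eq_bigr => i _; rewrite coefZ scalerA. Qed.

Lemma revp0 D : revp D 0 = 0.
Proof. by rewrite /revp big1 // => i _; rewrite coef0 scale0r. Qed.

Lemma revp_sum D I (r : seq I) (F : I -> {poly R}) :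
  revp D (\sum_(i <- r) F i) = \sum_(i <- r) revp D (F i).
Proof. exact: (big_morph (revp D) (revpD D) (revp0 D)). Qed.

Lemma revpXn D k : (k <= D)%N -> revp D 'X^k = 'X^(D - k).
Proof.
move=> le; rewrite /revp (bigD1 (Ordinal (le : k < D.+1)%N)) //= coefXn eqxx scale1r.
rewrite big1 ?addr0 // => i; rewrite -val_eqE /= => /negbTE h.
by rewrite coefXn h scale0r.
Qed.

Lemma poly_sum_wide D p : (size p <= D.+1)%N -> p = \sum_(i < D.+1) p`_i *: 'X^i.
Proof.
move=> h; rewrite -poly_def; apply/polyP => i; rewrite coef_poly.
by case: ltnP => // hi; rewrite nth_default // (leq_trans h).
Qed.

Lemma revpM D E p q : (size p <= D.+1)%N -> (size q <= E.+1)%N ->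
  revp (D + E) (p * q) = revp D p * revp E q.
Proof.
move=> hp hq; rewrite {1}(poly_sum_wide hp) {1}(poly_sum_wide hq).
rewrite mulr_suml revp_sum [in RHS]/revp [RHS]mulr_suml; apply: eq_bigr => i _.
rewrite -scalerAl revpZ -scalerAl; congr (_ *: _).
rewrite mulr_sumr revp_sum /revp [RHS]mulr_sumr -/(revp _ _); apply: eq_bigr => j _.
rewrite -scalerAr -/(revp (D + E) _) revpZ -scalerAr; congr (_ *: _).
have := ltn_ord i; have := ltn_ord j => hj hi.
rewrite -exprD revpXn; last by rewrite leq_add.
by rewrite -exprD; congr 'X^_; lia.
Qed.

Lemma coef_revp D p i : (i <= D)%N -> (revp D p)`_i = p`_(D - i).
Proof.
move=> le; rewrite coef_sum.
have h : (D - i < D.+1)%N by rewrite ltnS leq_subr.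
rewrite (bigD1 (Ordinal h)) //= coefZ coefXn subKn // eqxx mulr1.
rewrite big1 ?addr0 // => j; rewrite -val_eqE /= => hj.
rewrite coefZ coefXn; case: eqP => [e|_]; last by rewrite mulr0.
by case/negP: hj; have := ltn_ord j; rewrite e; lia.
Qed.

Lemma size_revp D p : (size (revp D p) <= D.+1)%N.
Proof.
apply: (leq_trans (size_sum _ _ _)); apply/bigmax_leqP => i _.
by rewrite (leq_trans (size_scale_leq _ _)) // size_polyXn ltnS leq_subr.
Qed.

Lemma revpK D p : (size p <= D.+1)%N -> revp D (revp D p) = p.
Proof.
move=> h; apply/polyP => i; have [le|lt] := leqP i D.
  by rewrite !coef_revp ?leq_subr // subKn.
rewrite !nth_default // ?(leq_trans h) //.
by apply: leq_trans lt; exact: size_revp.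
Qed.

Lemma ip_revp D u v : (size v <= D.+1)%N -> ip u v = (u * revp D v)`_D.
Proof.
move=> h; rewrite coefM (@ip_wide (maxn (size u) D.+1)) ?leq_maxl //.
rewrite (big_ord_widen _ (fun i => u`_i * (revp D v)`_(D - i)) (leq_maxr (size u) D.+1)).
rewrite [RHS]big_mkcond; apply: eq_bigr => i _; case: ltnP => hi.
  by rewrite coef_revp ?leq_subr // subKn.
by rewrite [v`_i]nth_default ?mulr0 // (leq_trans h).
Qed.

Definition energy u := ip u u.

(** Write Q for the reflection of P.  Then <P g, P g> = <Q P g, g>, so that
    Cauchy-Schwarz bounds it by the norms of Q P g and g; and Q P g has the norm of
    P P g, because both squares are the same coefficient of the product of two
    factors P, two factors Q, g and its reflection. *)
Lemma energy_logconvex P g : energy (P * g) ^+ 2 <= energy (P * (P * g)) * energy g.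
Proof.
pose D := size P; pose G := size g; pose Q := revp D P.
have sP : (size P <= D.+1)%N by exact: leqnSn.
have sg : (size g <= G.+1)%N by exact: leqnSn.
have sQ : (size Q <= D.+1)%N by exact: size_revp.
have sM (u v : {poly R}) m n : (size u <= m.+1)%N -> (size v <= n.+1)%N ->
    (size (u * v)%R <= (m + n).+1)%N.
  by move=> hu hv; apply: (leq_trans (size_polyMleq _ _)); lia.
have sX : (size ('X^D : {poly R}) <= D.+1)%N by rewrite size_polyXn.
have rX : revp D 'X^D = 1 by rewrite revpXn // subnn.
(* The factor X^D turns the reflection of degree D + G of P * g into the one
   of degree G of g. *)
have e1 : energy (P * g) = ip (P * (Q * g)) ('X^D * g).
  rewrite /energy (@ip_revp (D + G)) ?sM // (@ip_revp (D + G)) ?sM //.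
  by rewrite !revpM // rX -/Q; congr ((_ : {poly R})`_ _); ring.
have e2 : energy ('X^D * g) = energy g.
  rewrite /energy (@ip_revp (D + G)) ?sM // revpM // rX mul1r -mulrA coefXnM.
  by rewrite ltnNge leq_addr /= addKn -ip_revp.
have e3 : energy (P * (Q * g)) = energy (P * (P * g)).
  rewrite /energy !(@ip_revp (D + (D + G))) ?sM //.
  rewrite !revpM ?sM // revpK // -/Q; congr ((_ : {poly R})`_ _); ring.
by rewrite e1 -e2 -e3; exact: ip_cauchy.
Qed.

Lemma energy_ge0 u : 0 <= energy u.
Proof. by apply: sumr_ge0 => i _; rewrite -expr2 sqr_ge0. Qed.

(** In a log-convex sequence the ratios increase. *)
Lemma energy_power P f (k : R) n : 0 <= k -> 0 < energy f ->
  k * energy f < energy (P * f) -> k ^+ n * energy f <= energy (P ^+ n * f).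
Proof.
move=> k0 f0 h.
suff [] : k ^+ n * energy f <= energy (P ^+ n * f) /\
   [/\ 0 < energy (P ^+ n * f), 0 < energy (P ^+ n.+1 * f) &
       k * energy (P ^+ n * f) <= energy (P ^+ n.+1 * f)] by [].
elim: n => [|n [IH [h1 h2 h3]]].
  rewrite !expr0 !mul1r expr1; split=> //; split=> //; last exact: ltW.
  by apply: le_lt_trans h; rewrite mulr_ge0 // ltW.
split.
  by apply: le_trans h3; rewrite exprS -mulrA ler_wpM2l.
have eS m : P * (P ^+ m * f) = P ^+ m.+1 * f by rewrite mulrA -exprS.
have := energy_logconvex P (P ^+ n * f); rewrite !eS => lc.
have h4 : 0 < energy (P ^+ n.+2 * f).
  rewrite lt_neqAle energy_ge0 andbT; apply/eqP => e.
  by move: lc; rewrite -e mul0r leNgt exprn_gt0.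
split=> //; rewrite -(ler_pM2r h1); apply: le_trans lc.
by rewrite mulrAC expr2 ler_wpM2r // ltW.
Qed.

Lemma coefM_le P q (mx : R) i : nonneg q -> (forall j, P`_j <= mx) ->
  0 <= mx -> (P * q)`_i <= mx * q.[1].
Proof.
move=> q0 h mx0; rewrite mulrC coef_expect expectM.
apply: (le_trans (y := expect q (fun=> mx))); last by rewrite expect_cst mulrC.
apply: expect_le => // j _; have [ji|ij] := leqP j i.
  apply: le_trans (h (i - j)%N); rewrite [leRHS]coef_expect le_eqVlt; apply/orP; left.
  by apply/eqP/eq_expect => k; congr (_%:R); congr nat_of_bool; lia.
rewrite /expect big1 // => k _.
by case: eqP => [e|_]; [exfalso; lia|rewrite mulr0].
Qed.

(** Here f is thought of as the indicator of a set with f.[1] points.  If the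
    conclusion failed, [energy_power] would give P^n f a squared norm greater than
    k^n f.[1], whereas it is at most its largest coefficient times its mass, that
    is, mx f.[1]^2. *)
Lemma energy_decay P f (k mx : R) n : nonneg P -> nonneg f -> P.[1] <= 1 ->
  energy f = f.[1] -> 0 < k -> 0 <= mx -> (forall i, (P ^+ n)`_i <= mx) ->
  f.[1] * mx < k ^+ n -> energy (P * f) <= k * f.[1].
Proof.
move=> P0 f0 P1 ef k0 mx0 hmx hk.
have [e0|e0] := eqVneq f.[1] 0.
  by rewrite (nonneg_mass0 f0 e0) mulr0 horner0 mulr0 /energy /ip expect0.
have m0 : 0 < f.[1] by rewrite lt_neqAle eq_sym e0 mass_ge0.
rewrite leNgt; apply/negP => h.
have := @energy_power P f k n (ltW k0); rewrite ef => /(_ m0 h).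
rewrite leNgt => /negP; apply.
have Pn0 : nonneg (P ^+ n).
  by elim: (n) => [|j IH]; [rewrite expr0; exact: nonneg1|rewrite exprS; exact: nonnegM].
have u0 : nonneg (P ^+ n * f) by exact: nonnegM.
have P1' : 0 <= P.[1] by exact: mass_ge0.
apply: (le_lt_trans (y := f.[1] * (mx * f.[1]))); last by rewrite mulrA ltr_pM2r.
apply: (le_trans (y := expect (P ^+ n * f) (fun=> mx * f.[1]))).
  by apply: expect_le => // i _; exact: coefM_le.
rewrite expect_cst; apply: ler_wpM2r; first by rewrite mulr_ge0 // ltW.
rewrite hornerM horner_exp.
by rewrite ger_pMl // exprn_ile1.
Qed.

End Energy.

(** * From the l^2 gain on sets to an l^q gain *)

Section Lq.
Variable R : realType.
Implicit Types (p f g u v P : {poly R}) (q : R).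

Definition psum q u := \sum_(i < size u) u`_i `^ q.

Lemma psum_wide q n u : q != 0 -> (size u <= n)%N ->
  psum q u = \sum_(i < n) u`_i `^ q.
Proof.
move=> q0 le; rewrite /psum (big_ord_widen _ (fun i => u`_i `^ q) le).
rewrite big_mkcond; apply: eq_bigr => i _.
by case: ltnP => // h; rewrite nth_default // powR0.
Qed.

Lemma psum_ge0 q u : 0 <= psum q u.
Proof. by apply: sumr_ge0 => i _; exact: powR_ge0. Qed.

Lemma powR_le q (x y : R) : 0 <= q -> 0 <= x -> x <= y -> x `^ q <= y `^ q.
Proof.
by move=> q0 x0 xy; apply: ge0_ler_powR; rewrite ?nnegrE // (le_trans x0).
Qed.

Lemma psum_le q u v : 0 < q -> nonneg u -> (forall i, u`_i <= v`_i) ->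
  psum q u <= psum q v.
Proof.
move=> q0 u0 uv; pose n := maxn (size u) (size v).
rewrite (@psum_wide q n u) ?gt_eqF ?leq_maxl // (@psum_wide q n v) ?gt_eqF ?leq_maxr //.
by apply: ler_sum => i _; apply: powR_le => //; exact: ltW.
Qed.

Lemma psumZ q (c : R) u : 0 < q -> 0 <= c -> nonneg u ->
  psum q (c *: u) = c `^ q * psum q u.
Proof.
move=> q0 c0 u0; rewrite (@psum_wide q (size u)) ?gt_eqF ?size_scale_leq //.
by rewrite mulr_sumr; apply: eq_bigr => i _; rewrite coefZ powRM.
Qed.

(** A sum is at most the number of its terms times the largest one. *)
Lemma powR_sum q K (a : 'I_K -> R) : 0 < q -> (forall k, 0 <= a k) ->
  (\sum_k a k) `^ q <= K%:R `^ q * \sum_k a k `^ q.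
Proof.
case: K a => [|K] a q0 a0.
  by rewrite !big_ord0 mulr0 powR0 ?gt_eqF.
pose m := [arg max_(k > ord0) a k]%O.
have am k : a k <= a m by rewrite /m; case: arg_maxP => // i _; apply.
apply: (le_trans (y := (K.+1%:R * a m) `^ q)).
  apply: powR_le; [exact: ltW|exact: sumr_ge0|].
  apply: (le_trans (ler_sum _ (fun k _ => am k))).
  by rewrite sumr_const card_ord mulr_natl.
rewrite powRM // ler_wpM2l ?powR_ge0 // (bigD1 m) //= lerDl.
by apply: sumr_ge0 => k _; exact: powR_ge0.
Qed.

Lemma psum_sum q K (h : 'I_K -> {poly R}) : 0 < q -> (forall k, nonneg (h k)) ->
  psum q (\sum_k h k) <= K%:R `^ q * \sum_k psum q (h k).
Proof.
move=> q0 h0; pose n := \max_k size (h k).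
have hn k : (size (h k) <= n)%N by exact: (leq_bigmax (F := fun k => size (h k))).
have sn : (size (\sum_k h k)%R <= n)%N by apply: (leq_trans (size_sum _ _ _)).
rewrite (@psum_wide q n) ?gt_eqF //.
under [X in _ <= _ * X]eq_bigr => k _ do rewrite (@psum_wide q n) ?gt_eqF //.
rewrite exchange_big mulr_sumr; apply: ler_sum => i _.
by rewrite coef_sum; apply: powR_sum => // k; exact: h0.
Qed.

(** For c = 1, 1/2, 1/4 and so on the layers are the dyadic level sets of f. *)
Definition floorp (c : R) f : {poly R} :=
  \poly_(i < size f) (if f`_i <= c then f`_i else 0).

Definition layer (c : R) f : {poly R} :=
  \poly_(i < size f) (if c / 2 < f`_i <= c then f`_i else 0).

Definition layer_ind (c : R) f : {poly R} :=
  \poly_(i < size f) (c / 2 < f`_i <= c)%R%:R.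

Lemma coef_floorp c f i : 0 <= c -> (floorp c f)`_i = if f`_i <= c then f`_i else 0.
Proof.
move=> c0; rewrite coef_poly; case: ltnP => // h.
by rewrite nth_default // c0.
Qed.

Lemma coef_layer c f i : (layer c f)`_i = if c / 2 < f`_i <= c then f`_i else 0.
Proof.
rewrite coef_poly; case: ltnP => // h.
by rewrite nth_default //; case: ifP.
Qed.

Lemma coef_layer_ind c f i : 0 <= c -> (layer_ind c f)`_i = (c / 2 < f`_i <= c)%R%:R.
Proof.
move=> c0; rewrite coef_poly; case: ltnP => // h.
by rewrite nth_default // ltNge divr_ge0.
Qed.

Lemma floorp_ge0 c f : 0 <= c -> nonneg f -> nonneg (floorp c f).
Proof. by move=> c0 f0 i; rewrite coef_floorp //; case: ifP. Qed.

Lemma layer_ge0 c f : nonneg f -> nonneg (layer c f).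
Proof. by move=> f0 i; rewrite coef_layer; case: ifP. Qed.

Lemma layer_ind_ge0 c f : 0 <= c -> nonneg (layer_ind c f).
Proof. by move=> c0 i; rewrite coef_layer_ind. Qed.

Lemma layers f J : nonneg f -> (forall i, f`_i <= 1) ->
  f = floorp (2^-1 ^+ J) f + \sum_(j < J) layer (2^-1 ^+ j) f.
Proof.
move=> f0 f1; elim: J => [|J IH].
  by rewrite big_ord0 addr0; apply/polyP => i; rewrite coef_floorp // expr0 f1.
rewrite {1}IH big_ord_recr /= addrCA addrC; congr (_ + _).
set c : R := 2^-1 ^+ J.
have c0 : 0 <= c by rewrite /c exprn_ge0 // invr_ge0.
have cE : 2^-1 ^+ J.+1 = c / 2 by rewrite exprS mulrC.
apply/polyP => i; rewrite coefD cE !coef_floorp ?coef_layer ?divr_ge0 //.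
have := f0 i; have [h1|h1] := leP (f`_i) (c / 2).
  by rewrite /= addr0 (le_trans h1) // ler_pdivrMr // ler_peMr // ler1n.
by rewrite /= add0r.
Qed.

Lemma mass_sum u : u.[1] = \sum_(i < size u) u`_i.
Proof. by rewrite horner_coef; apply: eq_bigr => i _; rewrite expr1n mulr1. Qed.

Lemma psum_small q u (c : R) : 1 < q -> nonneg u -> u.[1] <= 1 ->
  (forall i, u`_i <= c) -> psum q u <= c `^ (q - 1).
Proof.
move=> q1 u0 u1 uc.
have q0 : 0 < q by apply: lt_trans q1.
apply: (le_trans (y := c `^ (q - 1) * u.[1])); last first.
  by rewrite ler_piMr ?powR_ge0.
rewrite mass_sum mulr_sumr; apply: ler_sum => i _.
rewrite -mulr_powRB1 // mulrC ler_wpM2r //; apply: powR_le => //.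
by rewrite subr_ge0 ltW.
Qed.

(** Split at the height k: there x^q' <= k^(q' - 1) x below and
    x^q' <= k^(q' - 2) x^2 above, because q' is between 1 and 2. *)
Lemma psum_energy q q' g (k m : R) : 1 < q' -> q' <= 2 -> q' <= q -> 0 < k ->
  nonneg g -> (forall i, g`_i <= 1) -> g.[1] <= m -> energy g <= k * m ->
  psum q g <= 2 * k `^ (q' - 1) * m.
Proof.
move=> q'1 q'2 q'q k0 g0 g1 gm eg.
have q'0 : 0 < q' by apply: lt_trans q'1.
have pt (x : R) : 0 <= x -> x <= 1 ->
    x `^ q <= k `^ (q' - 1) * x + k `^ (q' - 2) * x ^+ 2.
  move=> x0 x1; apply: (le_trans (y := x `^ q')).
    have [->|xn] := eqVneq x 0; first by rewrite !powR0 // gt_eqF // (lt_le_trans q'0).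
    by apply: ger_powR => //; rewrite lt_neqAle eq_sym xn x0.
  have [xk|kx] := leP x k.
    rewrite ler_wpDr ?mulr_ge0 ?powR_ge0 ?sqr_ge0 //.
    rewrite -mulr_powRB1 // mulrC ler_wpM2r //; apply: powR_le => //.
    by rewrite subr_ge0 ltW.
  rewrite ler_wpDl ?mulr_ge0 ?powR_ge0 //.
  have xp : 0 < x by apply: lt_trans kx.
  have -> : x `^ q' = x `^ (q' - 2) * x ^+ 2.
    by rewrite -powR_mulrn // -powRD ?subrK // (gt_eqF xp) implybT.
  rewrite ler_wpM2r ?sqr_ge0 //.
  rewrite -[q' - 2]opprB !powRN lef_pV2 ?posrE ?powR_gt0 //.
  by apply: powR_le; rewrite ?subr_ge0 // ltW.
apply: (le_trans (y := k `^ (q' - 1) * g.[1] + k `^ (q' - 2) * energy g)).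
  rewrite mass_sum /energy /ip /expect !mulr_sumr -big_split; apply: ler_sum => i _.
  by rewrite -expr2 pt.
have e : k `^ (q' - 2) * k = k `^ (q' - 1).
  rewrite -{2}[k]powRr1 ?ltW // -powRD; last by rewrite (gt_eqF k0) implybT.
  by congr (_ `^ _); ring.
have h1 := ler_wpM2l (powR_ge0 k (q' - 1)) gm.
have h2 := ler_wpM2l (powR_ge0 k (q' - 2)) eg.
rewrite mulrA e in h2; lra.
Qed.

(** On the layer of height c = 2^-j, f is at most c times the indicator of a set
    with at most 2^(j + 1) <= 2^J points, which is small enough for
    [energy_decay]; and the q-th power sum of f is at least (c / 2)^q times the
    number of these points.  What is left after J layers is at most 2^-J. *)
Lemma psum_flat q q' f P J (k mx : R) n :
  1 < q' -> q' <= 2 -> q' <= q -> nonneg f -> nonneg P ->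
  f.[1] <= 1 -> P.[1] <= 1 -> 0 < k -> 0 <= mx -> (forall i, (P ^+ n)`_i <= mx) ->
  2 ^+ J * mx < k ^+ n ->
  psum q (P * f) <= J.+1%:R `^ q * ((2^-1 ^+ J) `^ (q - 1) +
     J%:R * (2 * 2 `^ q * k `^ (q' - 1) * psum q f)).
Proof.
move=> q'1 q'2 q'q f0 P0 f1 P1 k0 mx0 hmx hk.
have q1 : 1 < q by apply: lt_le_trans q'q.
have q0 : 0 < q by apply: lt_trans q1.
have fi1 i : f`_i <= 1 by apply: le_trans f1; exact: coef_le_mass.
have half_ge0 j : 0 <= 2^-1 ^+ j :> R by rewrite exprn_ge0 // invr_ge0.
rewrite {1}(layers J f0 fi1) mulrDr mulr_sumr.
pose h (k : 'I_J.+1) := if k is Ordinal k'.+1 _ then P * layer (2^-1 ^+ k') f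
  else P * floorp (2^-1 ^+ J) f.
have -> : P * floorp (2^-1 ^+ J) f + \sum_(i < J) P * layer (2^-1 ^+ i) f = \sum_k h k.
  by rewrite big_ord_recl; congr (_ + _); apply: eq_bigr => -[i hi] _ /=.
apply: (le_trans (psum_sum (h := h) q0 _)).
  move=> [[|i] hi] /=; apply: nonnegM => //; first exact: floorp_ge0 (half_ge0 _) f0.
  exact: layer_ge0 f0.
rewrite ler_wpM2l ?powR_ge0 // big_ord_recl; apply: lerD.
  rewrite /h /=; apply: psum_small => //.
  - by apply: nonnegM => //; exact: floorp_ge0 (half_ge0 _) f0.
  - rewrite hornerM; apply: mulr_ile1 => //; try exact: mass_ge0.
      by apply: mass_ge0; exact: floorp_ge0 (half_ge0 _) f0.
    apply: le_trans f1; rewrite -[leRHS]mulr1 -[leLHS]mulr1 -!expect_cst.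
    rewrite (@expect_wide _ (size f)) ?size_poly // /expect.
    by apply: ler_sum => i _; rewrite !mulr1 coef_floorp //; case: ifP.
  - move=> i; apply: le_trans (_ : 2^-1 ^+ J * P.[1] <= _); last by rewrite ler_piMr.
    rewrite mulrC; apply: coefM_le => // j.
    by rewrite coef_floorp //; case: ifP.
apply: (le_trans (y := \sum_(j < J) (2 * 2 `^ q * k `^ (q' - 1) * psum q f))); last first.
  by rewrite sumr_const card_ord -[leLHS]mulr_natl.
apply: ler_sum => -[j hj] _; rewrite /h /=.
set c : R := 2^-1 ^+ j; set L := layer c f; set I := layer_ind c f.
have c0 : 0 < c by rewrite exprn_gt0 // invr_gt0.
have c0' := ltW c0.
have I0 : nonneg I by exact: layer_ind_ge0 (ltW c0).
have L0 : nonneg L by exact: layer_ge0.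
have LI i : L`_i <= (c *: I)`_i.
  rewrite coefZ coef_layer coef_layer_ind //.
  by case: ifP => [/andP[_ h1]|_]; rewrite /= ?mulr1 ?mulr0 ?h1.
have card : I.[1] <= 2 ^+ J.
  apply: (le_trans (y := 2 ^+ j.+1)); last first.
    by rewrite ler_eXn2l ?ltr1n.
  have : c / 2 * I.[1] <= 1.
    apply: le_trans f1; rewrite -[leRHS]mulr1 -[I.[1]]mulr1 -!expect_cst -expect_mulf.
    rewrite (@expect_wide _ (size f)) ?size_poly // /expect.
    apply: ler_sum => i _; rewrite !mulr1 coef_layer_ind //.
    by case: (boolP (_ && _)) => [/andP[h1 _]|_]; rewrite /= ?mul1r ?mul0r ?mulr1 ?mulr0 // ltW.
  have -> : c / 2 = (2 ^+ j.+1)^-1 by rewrite /c exprVn exprS invfM mulrC.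
  by rewrite ler_pdivrMl ?exprn_gt0 // mulr1.
have eI : energy I = I.[1].
  rewrite /energy /ip -[RHS]mulr1 -expect_cst; apply: eq_bigr => i _.
  by rewrite coef_layer_ind //; case: (_ && _); rewrite ?mul0r.
have eP : energy (P * I) <= k * I.[1].
  apply: (@energy_decay _ P I k mx n) => //.
  by apply: le_lt_trans hk; rewrite ler_wpM2r.
have mP : (P * I).[1] <= I.[1] by rewrite hornerM ler_piMl // mass_ge0.
apply: (le_trans (y := psum q (c *: (P * I)))).
  apply: psum_le => //; first exact: nonnegM.
  move=> i; rewrite scalerAr [leLHS]coefM [leRHS]coefM.
  by apply: ler_sum => l _; rewrite ler_wpM2l.
have PI1 i : (P * I)`_i <= 1.
  apply: le_trans (_ : 1 * P.[1] <= _); last by rewrite mul1r.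
  rewrite mulrC; apply: coefM_le => // l; rewrite coef_layer_ind //.
  by case: (_ && _).
rewrite psumZ //; last exact: nonnegM.
have PI0 : nonneg (P * I) by exact: nonnegM.
apply: le_trans (ler_wpM2l (powR_ge0 _ _) (psum_energy q'1 q'2 q'q k0 PI0 PI1 mP eP)) _.
have low : (c / 2) `^ q * I.[1] <= psum q f.
  rewrite -[I.[1]]mulr1 -expect_cst -expect_mulf.
  rewrite (@expect_wide _ (size f)) ?size_poly // /psum.
  apply: ler_sum => i _; rewrite mulr1 coef_layer_ind //.
  case: (boolP (_ && _)) => [/andP[h1 _]|_]; rewrite ?mul1r ?mul0r ?powR_ge0 //.
  by apply: powR_le; rewrite ?divr_ge0 // ltW.
have -> : c `^ q = 2 `^ q * (c / 2) `^ q.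
  by rewrite -powRM ?divr_ge0 // mulrC divfK.
have kq := powR_ge0 k (q' - 1); have tq := powR_ge0 (2:R) q.
have := ler_wpM2l (mulr_ge0 tq kq) low; lra.
Qed.

End Lq.

(** * Powers of a regular measure are almost flat *)

Section Decay.
Variable R : realType.

Definition ahlfors_size (alpha : R) (m r : nat) : R := (r%:R / 2 ^+ m) `^ alpha.

Lemma natr_ub (x : R) : exists n : nat, (0 < n)%N /\ x <= n%:R.
Proof.
by exists (Num.truncn x).+1; split=> //; apply/ltW/truncnS_gt.
Qed.

(** The parameters are chosen in this order: H makes the upper regularity at
    scale 2 / H beat the lower one; M makes M^(eta / 2) exceed the loss k0 of one
    scale, which depends on H; s makes 4^s at least the number 25 M s H of windows
    in [coef_decay].  Then one block of s levels loses at most M^(s eta). *)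
Lemma power_decay (alpha C eta : R) : 0 < alpha -> alpha < 1 -> 0 < C ->
    0 < eta -> eta < 1 ->
  exists n N : nat, [/\ (0 < n)%N, (0 < N)%N & forall (m : nat) (p : {poly R}),
    regular p (ahlfors_size alpha m) C (2 ^ m) -> p.[1] <= 1 ->
    forall i, (p ^+ n)`_i <= N%:R * (2 ^+ m) `^ (- (1 - eta))].
Proof.
move=> a0 a1 C0 e0 e1.
have [h [h0 hh]] := natr_ub ((12 * C ^+ 2) `^ alpha^-1).
pose H := (4 * h)%N.
have H4 : (4 <= H)%N by rewrite /H; lia.
have hC : 12 * C ^+ 2 <= (2 * h)%N%:R `^ alpha.
  have -> : 12 * C ^+ 2 = ((12 * C ^+ 2) `^ alpha^-1) `^ alpha.
    by rewrite -powRrM mulVf ?gt_eqF // powRr1 // mulr_ge0 // sqr_ge0.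
  apply: powR_le; [exact: ltW|exact: powR_ge0|].
  by apply: le_trans hh _; rewrite ler_nat; lia.
pose k0 := locked (spread_cst (H%:R : R)).
have k0_4 : 4 <= k0 by rewrite /k0 -lock spread_cst_ge4.
have k0_gt0 : 0 < k0 by lra.
have [t [t0 ht]] := natr_ub (k0 `^ (eta / 2)^-1).
pose M := (3 * H * t)%N.
have M12 : (12 <= M)%N by rewrite /M -[12%N]/(3 * 4 * 1)%N !leq_mul.
have M0 : (0 < M)%N by apply: leq_trans M12.
have MR0 : 0 < M%:R :> R by rewrite ltr0n.
have HM : (H %| M)%N by rewrite /M; apply/dvdnP; exists (3 * t)%N; ring.
have M2 : (2 %| M)%N by rewrite /M /H; apply/dvdnP; exists (6 * h * t)%N; ring.
pose d := M%:R `^ (eta / 2) : R.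
have kd : k0 <= d.
  have -> : k0 = (k0 `^ (eta / 2)^-1) `^ (eta / 2).
    by rewrite -powRrM mulVf ?powRr1 ?gt_eqF ?divr_gt0 // ltW.
  apply: powR_le; [by rewrite divr_ge0 // ltW|exact: powR_ge0|].
  by apply: le_trans ht _; rewrite ler_nat /M leq_pmull // muln_gt0 /=; apply: leq_trans H4.
have d0 : 0 < d by apply: lt_le_trans kd.
have HE : H = (4 * h)%N by [].
have k0E : k0 = spread_cst H%:R by rewrite /k0 -lock.
clearbody M k0 H; clear ht hh.
(* With this s the number of windows 25 M s H is s^2 <= 4^s. *)
pose s := (25 * M * H)%N.
have s0 : (0 < s)%N by rewrite /s !muln_gt0 M0 /=; apply: leq_trans H4.
pose N := (M ^ s)%N.
have N1 : (1 < N)%N.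
  by rewrite -[X in (X < _)%N](exp1n s) ltn_exp2r //; apply: leq_trans M12.
have NR0 : 0 < N%:R :> R by rewrite ltr0n; lia.
pose kap := k0 / M%:R.
pose Theta : R := (25 * M * s * H)%N%:R * kap ^+ s.
have Theta_le : Theta <= N%:R `^ (- (1 - eta)).
  have -> : N%:R `^ (- (1 - eta)) = d ^+ s * d ^+ s / M%:R ^+ s.
    have imp (x : R) : (x == 0) ==> (M%:R != 0 :> R) by rewrite (gt_eqF MR0) implybT.
    have pw (x : R) : (M%:R `^ x) ^+ s = M%:R `^ (x * s%:R).
      by rewrite -powR_mulrn ?powR_ge0 // powRrM.
    rewrite /d !pw -[M%:R ^+ s]powR_mulrn ?ler0n // -powRN -!powRD ?imp //.
    by rewrite /N natrX -powR_mulrn ?ler0n // -powRrM; congr (_ `^ _); field.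
  rewrite /Theta /kap exprMn exprVn mulrA ler_pM2r ?invr_gt0 ?exprn_gt0 //.
  apply: ler_pM; rewrite ?exprn_ge0 ?ler0n ?(ltW k0_gt0) //; last first.
    by rewrite lerXn2r ?nnegrE // ltW.
  apply: (le_trans (y := 4 ^+ s)); last first.
    by rewrite lerXn2r ?nnegrE ?(ltW d0) //; lra.
  rewrite -natrX ler_nat (_ : (_ * H)%N = s * s)%N; last by rewrite /s; ring.
  by rewrite (expnMn 2 2 s : (4 ^ s = _)%N) leq_mul // ltnW // ltn_expl.
have Theta0 : 0 <= Theta.
  by rewrite mulr_ge0 ?ler0n ?exprn_ge0 // divr_ge0 ?ler0n // ltW.
clearbody s.
exists (s * (M ^ 2 + M ^ 2))%N, N; split.
- by rewrite !muln_gt0 s0 addn_gt0 expn_gt0 M0.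
- exact: ltnW.
move=> m p reg p1 x.
pose I := trunc_log N (2 ^ m).
have NI : (N ^ I <= 2 ^ m)%N by apply: trunc_logP => //; rewrite expn_gt0.
have NI' : (2 ^ m < N ^ I.+1)%N by apply: trunc_log_ltn.
have MJ : (M ^ (s * I) <= 2 ^ m)%N by rewrite expnM.
have tm : 0 < 2 ^+ m :> R by rewrite exprn_gt0.
have Age0 r : 0 <= ahlfors_size alpha m r by exact: powR_ge0.
have Amul a r : ahlfors_size alpha m (a * r) = a%:R `^ alpha * ahlfors_size alpha m r.
  by rewrite /ahlfors_size natrM -mulrA powRM // divr_ge0 ?ler0n ?ltW.
have A2 r : ahlfors_size alpha m (2 * r) <= 2 * ahlfors_size alpha m r.
  by rewrite Amul ler_wpM2r //; apply: ler1_powR; rewrite ?ler1n // ltW.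
have AH r : 12 * C ^+ 2 * ahlfors_size alpha m (r + r) <= ahlfors_size alpha m (H * r).
  have -> : (H * r = (2 * h) * (r + r))%N by rewrite HE; ring.
  by rewrite (Amul (2 * h)%N) ler_wpM2r.
have H3 : (3 <= H)%N by apply: ltnW.
have T := cell_tree reg C0 A2 AH HM M2 M12 H3 MJ.
have dec := @coef_power_decay R M H (s * I) _ HM (ltnW (ltnW H3)) M0 T s s0 I p x
  (leqnn _) (cells_whole _ _ _ _ _).
rewrite -k0E -/kap -/Theta in dec.
apply: le_trans dec _.
apply: (le_trans (y := Theta ^+ I)).
  rewrite ler_piMr ?exprn_ge0 //.
  by rewrite exprn_ile1 // mass_ge0 //; exact: regular_ge0 reg.
apply: (le_trans (y := (N%:R `^ (- (1 - eta))) ^+ I)).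
  by rewrite lerXn2r ?nnegrE ?powR_ge0.
apply: (le_trans (y := N%:R `^ (1 - eta) * (2 ^+ m) `^ (- (1 - eta)))); last first.
  rewrite ler_wpM2r ?powR_ge0 //; apply: ler1_powR; last by lra.
  by rewrite ler1n ltnW.
rewrite powRN [in leRHS]powRN -powR_mulrn ?invr_ge0 ?powR_ge0 //.
rewrite -powR_inv1 ?powR_ge0 // -!powRrM.
rewrite ler_pdivlMr ?powR_gt0 //.
have -> : N%:R `^ ((1 - eta) * (-1 * I%:R)) = (N%:R ^+ I) `^ (- (1 - eta)) :> R.
  by rewrite -powR_mulrn ?ler0n // -powRrM; congr (_ `^ _); ring.
rewrite powRN mulrC ler_pdivrMr ?powR_gt0 ?exprn_gt0 // -powRM ?exprn_ge0 ?ler0n //.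
apply: powR_le; [lra|exact: ltW|].
by rewrite -exprS -!natrX ler_nat ltnW.
Qed.

End Decay.

(** * Discretising Borel probabilities on the line *)

Local Open Scope classical_set_scope.
Local Open Scope ring_scope.

Section Discretisation.
Variable R : realType.
Implicit Types (P mu nu : borel_probability R) (S : set R).

Definition pr P S : R := fine (P S).

Lemma prE P S : measurable S -> P S = (pr P S)%:E.
Proof. by move=> mS; rewrite /pr fineK // fin_num_measure. Qed.

Lemma pr_ge0 P S : 0 <= pr P S.
Proof. by rewrite /pr fine_ge0. Qed.

Lemma pr_le P S S' : measurable S -> measurable S' -> S `<=` S' -> pr P S <= pr P S'.
Proof.
move=> mS mS' SS'; rewrite -lee_fin -!prE //.
by apply: le_measure => //; rewrite inE.
Qed.

Lemma prU P S S' : measurable S -> measurable S' -> S `&` S' = set0 ->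
  pr P (S `|` S') = pr P S + pr P S'.
Proof.
move=> mS mS' SS'; apply: EFin_inj; rewrite EFinD -!prE //; last exact: measurableU.
by rewrite measureU.
Qed.

(** The complement of the support is the union of the null intervals with
    rational endpoints. *)
Lemma spt_full P : P.-negligible (~` spt P).
Proof.
pose F (n : nat) : set (measurableTypeR R) := if unpickle n is Some (a, b) then
  if P `]ratr a, ratr b[%classic == 0%E then `]ratr a, ratr b[%classic else set0 else set0.
suff sub : ~` spt P `<=` \bigcup_n F n.
  apply: (@negligibleS _ (measurableTypeR R) R P _ _ sub).
  apply: negligible_bigcup => n; rewrite /F.
  case: unpickle => [[a b]|]; last exact: negligible_set0.
  case: ifPn => [/eqP h|_]; last exact: negligible_set0.
  by exists `]ratr a, ratr b[%classic; split.
move=> x /existsNP[r /not_implyP[r0 /negP]]; rewrite -leNgt => hr.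
have P0 : P (ball x r) = 0%E by apply/eqP; rewrite eq_le hr measure_ge0.
have xr : x - r < x by rewrite ltrBlDr ltrDl.
have xr' : x < x + r by rewrite ltrDl.
have [a] := rat_in_itvoo xr; rewrite in_itv /= => /andP[a1 a2].
have [b] := rat_in_itvoo xr'; rewrite in_itv /= => /andP[b1 b2].
exists (pickle (a, b)); [exact: I|rewrite /F pickleK].
have sub : `]ratr a, ratr b[%classic `<=` ball x r.
  move=> y; rewrite /= in_itv /= => /andP[y1 y2]; rewrite /ball /= ltr_distl.
  by rewrite ltrBlDr; lra.
have -> : P `]ratr a, ratr b[%classic = 0%E.
  apply/eqP; rewrite eq_le measure_ge0 andbT -P0.
  apply: le_measure => //; rewrite inE //; apply: open_measurable; exact: ball_open.
by rewrite eqxx /= in_itv /= a2 b1.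
Qed.

Lemma pr_off_spt P S : measurable S -> S `&` spt P = set0 -> pr P S = 0.
Proof.
move=> mS h; have : P.-negligible S.
  apply: (@negligibleS _ (measurableTypeR R) R P _ _ _ (spt_full P)) => x Sx sx.
  by have : (S `&` spt P) x by []; rewrite h.
by rewrite /pr => /negligibleP -> //.
Qed.

Definition supported (A : nat) P := pr P (~` `[- A%:R, A%:R[%classic) = 0.

Lemma compactly_supported_bound P : compactly_supported P -> exists A, supported A P.
Proof.
move=> /compact_bounded [M [_ hM]].
have [A [_ hA]] := natr_ub (M + 2); exists A.
apply: pr_off_spt; first exact: measurableC.
apply/seteqP; split=> // x [+ sx]; apply; rewrite /= in_itv /=.
have := hM (M + 1); rewrite ltrDl ltr01 => /(_ isT x sx); rewrite /= ler_norml; lra.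
Qed.

Definition cell_mass P m (k : int) := pr P (dyadic m k).

Definition grid m (k : int) : R := k%:~R / 2 ^+ m.

Lemma dyadicE m k : @dyadic R m k = `[grid m k, grid m (k + 1)[%classic.
Proof. by []. Qed.

Lemma two_gt0 m : 0 < 2 ^+ m :> R. Proof. by rewrite exprn_gt0. Qed.

Lemma grid_le m k l : (grid m k <= grid m l) = (k <= l).
Proof. by rewrite /grid ler_pM2r ?invr_gt0 ?two_gt0 // ler_int. Qed.

Lemma grid_cells P m (k : int) n :
  pr P `[grid m k, grid m (k + n%:Z)[%classic = \sum_(i < n) cell_mass P m (k + i%:Z).
Proof.
elim: n => [|n IH].
  by rewrite big_ord0 addr0 set_itvco0 /pr measure0.
rewrite big_ord_recr /= -IH /cell_mass dyadicE -prU //.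
  congr (pr P _); rewrite -addrA (_ : n%:Z + 1 = n.+1%:Z); last by lia.
  have h1 : grid m k <= grid m (k + n%:Z) by rewrite grid_le; lia.
  have h2 : grid m (k + n%:Z) <= grid m (k + n.+1%:Z) by rewrite grid_le; lia.
  apply/seteqP; split=> x; rewrite /= !in_itv /=.
    move=> /andP[x1 x2]; case: (ltP x (grid m (k + n%:Z))) => h; [left|right].
      by rewrite x1.
    by rewrite x2.
  by move=> [/andP[x1 x2]|/andP[x1 x2]]; apply/andP; split; lra.
by apply/seteqP; split=> x //=; rewrite !in_itv /= => -[/andP[_ h1] /andP[h2 _]]; lra.
Qed.

Lemma dyadic_mem m (x : R) : exists k, dyadic m k x.
Proof.
exists (Num.floor (x * 2 ^+ m)); rewrite dyadicE /= in_itv /= /grid.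
rewrite ler_pdivrMr ?two_gt0 // ltr_pdivlMr ?two_gt0 //.
by rewrite floor_le_tmp floorD1_gt.
Qed.

(** The shift by A 2^m makes the indices of the dyadic intervals between -A and A
    start at 0. *)
Definition disc P A m : {poly R} :=
  \poly_(i < A.*2 * 2 ^ m) cell_mass P m (i%:Z - (A * 2 ^ m)%:Z).

Lemma cell_outside P A m k : supported A P ->
  (k < - (A * 2 ^ m)%:Z) || ((A * 2 ^ m)%:Z <= k) -> cell_mass P m k = 0.
Proof.
move=> hA hk; apply: le_anti; rewrite pr_ge0 andbT -hA.
apply: pr_le; [exact: measurable_itv|exact: measurableC|].
have gA : A%:R = grid m (A * 2 ^ m)%:Z.
  by rewrite /grid -pmulrn natrM natrX mulfK // gt_eqF ?two_gt0.
have gA' : - A%:R = grid m (- (A * 2 ^ m)%:Z).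
  by rewrite gA /grid rmorphN mulNr.
move=> x; rewrite dyadicE /= !in_itv /= gA' gA => /andP[x1 x2].
case/orP: hk => hk.
  have : grid m (k + 1) <= grid m (- (A * 2 ^ m)%:Z) by rewrite grid_le; lia.
  by move=> h /andP[h1 _]; lra.
have : grid m (A * 2 ^ m)%:Z <= grid m k by rewrite grid_le.
by move=> h /andP[_ h1]; lra.
Qed.

Lemma coef_disc P A m i : supported A P ->
  (disc P A m)`_i = cell_mass P m (i%:Z - (A * 2 ^ m)%:Z).
Proof.
move=> hA; rewrite coef_poly; case: ltnP => // h.
rewrite (@cell_outside _ A) //; apply/orP; right.
by rewrite -muln2 in h; set X := (A * 2 ^ m)%N; have : (X * 2 <= i)%N; [rewrite mulnAC|lia].
Qed.

Lemma disc_ge0 P A m : nonneg (disc P A m).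
Proof. by move=> i; rewrite coef_poly; case: ifP => // _; exact: pr_ge0. Qed.

Lemma window_disc P A m n (x : int) : supported A P ->
  window n (disc P A m) x =
  pr P `[grid m (x - (A * 2 ^ m)%:Z), grid m (x - (A * 2 ^ m)%:Z + n%:Z)[%classic.
Proof.
move=> hA; rewrite grid_cells; elim: n => [|n IH].
  rewrite big_ord0 /window /expect big1 // => i _.
  by rewrite /win; case: (boolP (_ && _)) => [|_]; [lia|rewrite mulr0].
rewrite big_ord_recr /= -IH.
have -> : cell_mass P m (x - (A * 2 ^ m)%:Z + n%:Z) =
    expect (disc P A m) (fun i => (i%:Z == x + n%:Z)%:R).
  have [xn|xn] := ltP (x + n%:Z) 0.
    rewrite (@cell_outside _ A) //; last by apply/orP; left; lia.
    rewrite /expect big1 // => i _.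
    by case: eqP => [|_]; [lia|rewrite mulr0].
  pose y := absz (x + n%:Z); have yE : x + n%:Z = y%:Z by rewrite /y; lia.
  rewrite (_ : x - _ + _ = y%:Z - (A * 2 ^ m)%:Z); last by lia.
  by rewrite -coef_disc // coef_expect yE.
rewrite /window -expect_addf; apply: eq_expect => i.
rewrite /win; case: (boolP ((x <= i%:Z) && (i%:Z < x + n%:Z))) => h1;
  case: (boolP ((x <= i%:Z) && (i%:Z < x + n.+1%:Z))) => h2;
  case: (i%:Z =P x + n%:Z) => h3; rewrite ?addr0 ?add0r //; exfalso; lia.
Qed.

Lemma mass_disc P A m : supported A P -> (disc P A m).[1] = 1.
Proof.
move=> hA.
have -> : (disc P A m).[1] = window (A.*2 * 2 ^ m) (disc P A m) 0.
  rewrite -[LHS]mulr1 -expect_cst /window.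
  rewrite !(@expect_wide _ (A.*2 * 2 ^ m)) ?size_poly //; apply: eq_bigr => i _.
  rewrite /win; case: (boolP (_ && _)) => //; have := ltn_ord i; lia.
rewrite window_disc // add0r.
have -> : - (A * 2 ^ m)%:Z + (A.*2 * 2 ^ m)%:Z = (A * 2 ^ m)%:Z.
  by rewrite -muln2 mulnAC; lia.
have gA : grid m (A * 2 ^ m)%:Z = A%:R.
  by rewrite /grid -pmulrn natrM natrX mulfK // gt_eqF ?two_gt0.
have -> : grid m (- (A * 2 ^ m)%:Z) = - A%:R by rewrite -gA /grid rmorphN mulNr.
rewrite gA; set I := `[_, _[%classic.
have mI : measurable I by exact: measurable_itv.
have := prU P mI (measurableC mI); rewrite setICr setUCr => /(_ erefl).
by rewrite hA addr0 => <-; rewrite /pr probability_setT.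
Qed.

Lemma regular_disc P A m (alpha C : R) : supported A P -> 0 < C ->
  ahlfors_regular alpha C P ->
  regular (disc P A m) (ahlfors_size alpha m) C (2 ^ m).
Proof.
move=> hA C0 ar; set B := (A * 2 ^ m)%:Z.
have sz r : (0 < r < 2 ^ m)%N -> 0 < (r%:R / 2 ^+ m : R) < 1.
  move=> /andP[r0 rm]; rewrite divr_gt0 ?ltr0n ?two_gt0 //=.
  by rewrite ltr_pdivrMr ?two_gt0 // mul1r -natrX ltr_nat.
have gD k n : grid m (k + n%:Z) = grid m k + n%:R / 2 ^+ m.
  by rewrite /grid intrD mulrDl -pmulrn.
have mc x r : measurable (cball x r : set R) by exact: measurable_itv.
split; first exact: disc_ge0.
- move=> x r px rT.
  have [y [cy sy]] : (dyadic m (x%:Z - B) `&` spt P) !=set0.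
    apply/set0P/eqP => h; case/negP: px; rewrite coef_disc // /cell_mass.
    by rewrite pr_off_spt //; exact: measurable_itv.
  have := ar y _ sy (sz r rT); rewrite prE // !lee_fin => /andP[le _].
  apply: le_trans le _.
  have -> : expect (disc P A m) (ball_ind R r x) =
      window (r + r).+1 (disc P A m) (x%:Z - r%:Z).
    apply: eq_expect => i; rewrite /ball_ind /win.
    by case: (boolP (`|_| <= _)); case: (boolP (_ && _)) => //; lia.
  rewrite window_disc //; apply: pr_le => //.
  move: cy; rewrite dyadicE /= in_itv /= -/B.
  rewrite (_ : x%:Z - r%:Z - B = x%:Z - B - r%:Z); last by lia.
  have := gD (x%:Z - B - r%:Z) r; rewrite subrK => e1.
  have e2 : grid m (x%:Z - B + 1) = grid m (x%:Z - B) + 1 / 2 ^+ m := gD _ 1%N.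
  have e3 := gD (x%:Z - B - r%:Z) (r + r).+1.
  rewrite -[(r + r).+1%:R]natr1 natrD !mulrDl in e3.
  move=> /andP[y1 y2] z; rewrite /cball /= !in_itv /= => /andP[z1 z2].
  by apply/andP; split; lra.
- move=> z r rT; rewrite window_disc //; set I := `[_, _[%classic.
  have mI : measurable I by exact: measurable_itv.
  have [h|/set0P[y [Iy sy]]] := eqVneq (I `&` spt P) set0.
    by rewrite pr_off_spt // mulr_ge0 ?powR_ge0 // ltW.
  have := ar y _ sy (sz r rT); rewrite prE // !lee_fin => /andP[_ le].
  apply: le_trans le; apply: pr_le => //.
  move: Iy; rewrite /I /= in_itv /= gD => /andP[y1 y2] x.
  by rewrite /cball /= !in_itv /= => /andP[x1 x2]; apply/andP; split; lra.
Qed.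

End Discretisation.

(** * L^q sums and convolutions at a fixed scale *)

Section Convolution.
Variable R : realType.
Implicit Types (P mu nu : borel_probability R) (S : set R).

Lemma lq_sum P A m q : supported A P -> 0 < q ->
  fine (\esum_(k in [set: int]) poweR (P (dyadic m k)) q) = psum q (disc P A m).
Proof.
move=> hA q0; set N := (A.*2 * 2 ^ m)%N; set B := (A * 2 ^ m)%N.
have NB : N = (B + B)%N by rewrite /N /B -muln2 mulnAC muln2 addnn.
pose a (k : int) : \bar R := ((cell_mass P m k) `^ q)%:E.
have aE k : poweR (P (dyadic m k)) q = a k.
  by rewrite prE //; exact: measurable_itv.
pose f (i : nat) : int := i%:Z - B%:Z.
have -> : \esum_(k in [set: int]) poweR (P (dyadic m k)) q = \esum_(k in f @` `I_N) a k.
  rewrite [RHS]esum_mkcond; apply: eq_esum => k _; rewrite aE.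
  case: ifPn => // /negP hk; rewrite /a (@cell_outside _ _ A) ?powR0 ?gt_eqF //.
  apply: contra_notT hk; rewrite negb_or -!ltNge -leNgt -/B => /andP[h1 h2].
  rewrite inE; exists (absz (k + B%:Z)); rewrite /f /=; last by lia.
  by rewrite NB; lia.
rewrite (esum_image `I_N f a); last by move=> i j _ _; rewrite /f; lia.
rewrite esum_fset //; last by move=> i _; rewrite lee_fin powR_ge0.
rewrite -fsbig_ord sumEFin /= (@psum_wide _ q N) ?gt_eqF ?size_poly //.
by apply: eq_bigr => i _; rewrite coef_disc.
Qed.

Lemma conv_le mu nu S n (U V : nat -> set R) : measurable S ->
  (forall i, measurable (U i)) -> (forall i, measurable (V i)) ->
  (forall x y, S (x + y) -> exists i, [/\ (i < n)%N, U i x & V i y]) ->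
  pr (convolution mu nu) S <= \sum_(i < n) pr mu (U i) * pr nu (V i).
Proof.
move=> mS mU mV hS.
rewrite -lee_fin -prE // -sumEFin.
have mA : measurable (@addp R @^-1` S).
  by rewrite -[X in measurable X]setTI; apply: measurable_addp.
have -> : convolution mu nu S = (mu \x nu)%E (@addp R @^-1` S) by [].
have E (i : 'I_n) : (pr mu (U i) * pr nu (V i))%:E = (mu \x nu)%E (U i `*` V i).
  by rewrite EFinM -!prE // (product_measure1E mu nu (mU i) (mV i)).
rewrite (eq_bigr _ (fun i _ => E i)).
apply: (@content_subadditive _ _ _ (mu \x nu)%E _ (fun i => U i `*` V i)) => //.
  by move=> i _; exact: (measurableX (mU i) (mV i)).
move=> [x y] Sxy; have [i [ni Ux Vy]] := hS x y Sxy.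
by rewrite -(bigcup_mkord n (fun i => U i `*` V i)); exists i.
Qed.

Lemma supported_conv A B mu nu : supported A mu -> supported B nu ->
  supported (A + B) (convolution mu nu).
Proof.
move=> hA hB; apply/eqP; rewrite eq_le pr_ge0 andbT.
(* A sum outside [-A-B, A+B) has a summand outside its own interval. *)
pose IA : set R := ~` `[- A%:R, A%:R[%classic.
pose IB : set R := ~` `[- B%:R, B%:R[%classic.
pose U (i : nat) : set R := if i == 0%N then IA else setT.
pose V (i : nat) : set R := if i == 0%N then setT else IB.
have mA : measurable IA by exact: measurableC.
have mB : measurable IB by exact: measurableC.
apply: le_trans (@conv_le mu nu _ 2 U V _ _ _ _) _.
- exact: measurableC.
- by move=> i; rewrite /U; case: ifP.
- by move=> i; rewrite /V; case: ifP.
- move=> x y h.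
  have [hx|hx] := pselect (IA x); first by exists 0%N.
  exists 1%N; split=> // hy; apply: h; move: hx hy; rewrite /IA /= => /contrapT.
  rewrite /= !in_itv /= natrD => /andP[x1 x2] /andP[y1 y2].
  by apply/andP; split; lra.
by rewrite !big_ord_recl big_ord0 /U /V /= hA hB mul0r mulr0 !addr0.
Qed.

(** The sum of points of the i-th and the j-th dyadic interval lies in the
    interval of index i + j or i + j + 1; this is the factor 1 + X. *)
Lemma coef_conv A B mu nu m n : supported A mu -> supported B nu ->
  (disc (convolution mu nu) (A + B) m)`_n <=
  ((1 + 'X) * (disc nu B m * disc mu A m))`_n.
Proof.
move=> hA hB; rewrite (coef_disc _ _ (supported_conv hA hB)).
set p := disc mu A m; set q := disc nu B m.
pose a := (A * 2 ^ m)%N; pose b := (B * 2 ^ m)%N; pose N := (A.*2 * 2 ^ m)%N.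
have Na : N = (a + a)%N by rewrite /N /a -muln2 mulnAC muln2 addnn.
pose k : int := n%:Z - (a + b)%N%:Z.
have -> : n%:Z - ((A + B) * 2 ^ m)%N%:Z = k by rewrite /k /a /b mulnDl.
(* The extra index N collects the points x outside [-A, A), a null set. *)
pose U (i : nat) : set R := if (i < N)%N then dyadic m (i%:Z - a%:Z)
  else ~` `[- A%:R, A%:R[%classic.
pose V (i : nat) : set R := if (i < N)%N then
  `[grid R m (k - (i%:Z - a%:Z) - 1), grid R m (k - (i%:Z - a%:Z) - 1 + 2%N%:Z)[%classic
  else setT.
apply: (@le_trans _ _ (\sum_(i < N.+1) pr mu (U i) * pr nu (V i))).
  apply: conv_le.
  - exact: measurable_itv.
  - by move=> i; rewrite /U; case: ifP => _; [exact: measurable_itv|exact: measurableC].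
  - by move=> i; rewrite /V; case: ifP => _; [exact: measurable_itv|exact: measurableT].
  move=> x y; rewrite dyadicE /= in_itv /= => /andP[h1 h2].
  have [hx|hx] := pselect (`[- A%:R, A%:R[%classic x); last first.
    by exists N; rewrite /U /V ltnn; split.
  have [l hl] := dyadic_mem m x.
  have gA : A%:R = grid R m a%:Z.
    by rewrite /grid -pmulrn natrM natrX mulfK // gt_eqF ?two_gt0.
  have gA' : - A%:R = grid R m (- a%:Z) by rewrite gA /grid rmorphN mulNr.
  move: hx (hl); rewrite dyadicE /= !in_itv /= gA' gA => /andP[x1 x2] /andP[l1 l2].
  have e1 : l < a%:Z by rewrite -[_ < _](negbK) -leNgt -(grid_le R m) -ltNge; lra.
  have e2 : - a%:Z < l + 1 by rewrite -[_ < _](negbK) -leNgt -(grid_le R m) -ltNge; lra.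
  exists (absz (l + a%:Z)).
  have e3 : (absz (l + a%:Z))%:Z - a%:Z = l by lia.
  have e4 : (absz (l + a%:Z)%R < N)%N by rewrite Na; lia.
  rewrite /U /V e4 e3; split; [by lia|exact: hl|].
  have gB u v : grid R m (u - v) = grid R m u - grid R m v.
    by rewrite /grid rmorphB mulrBl.
  have gD u v : grid R m (u + v) = grid R m u + grid R m v.
    by rewrite /grid rmorphD mulrDl.
  rewrite /= in_itv /= (_ : k - l - 1 + 2%N%:Z = (k + 1) - l); last by lia.
  rewrite (_ : k - l - 1 = k - (l + 1)); last by lia.
  by rewrite (gB k) (gB (k + 1)); apply/andP; split; lra.
rewrite big_ord_recr /= {2}/U {2}/V ltnn hA mul0r addr0.
pose w := (1 + 'X) * q.
have -> : (1 + 'X) * (q * p) = p * w by rewrite /w; ring.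
have w0 : nonneg w.
  apply: nonnegM; last exact: disc_ge0.
  by move=> i; rewrite coefD coef1 coefX addr_ge0.
have cw i : cell_mass nu m (i%:Z - b%:Z - 1) + cell_mass nu m (i%:Z - b%:Z) = w`_i.
  rewrite /w mulrDl mul1r coefD coefXM -(coef_disc _ _ hB) -/q addrC; congr (_ + _).
  case: i => [|i] /=.
    by rewrite (cell_outside hB) //; apply/orP; left; rewrite -/b; lia.
  by rewrite (coef_disc _ _ hB) -/b; congr cell_mass; lia.
rewrite coef_expect expectM (@expect_wide _ N) ?size_poly //.
apply: ler_sum => i _.
rewrite /U ltn_ord -/(cell_mass mu m _) -(coef_disc _ _ hA) -/p.
apply: ler_wpM2l; first exact: disc_ge0.
rewrite /V ltn_ord grid_cells !big_ord_recl big_ord0 /= addr0 addr0.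
have [le|lt] := leqP i n.
  rewrite (_ : k - _ - 1 = (n - i)%N%:Z - b%:Z - 1); last by rewrite /k; lia.
  rewrite (_ : _ - 1 + _ = (n - i)%N%:Z - b%:Z); last by rewrite /bump; lia.
  rewrite cw coef_expect le_eqVlt; apply/orP; left; apply/eqP; apply: eq_expect => j.
  by congr (_%:R); congr nat_of_bool; lia.
rewrite !(cell_outside hB) ?addr0 ?expect_ge0 // -/b; apply/orP; left; rewrite /k ?/bump; lia.
Qed.

Lemma psum_mulX q (u : {poly R}) : 0 < q -> psum q ('X * u) = psum q u.
Proof.
move=> q0; rewrite (@psum_wide _ q (size u).+1) ?gt_eqF //; last first.
  by apply: (leq_trans (size_polyMleq _ _)); rewrite size_polyX.
rewrite big_ord_recl coefXM /= powR0 ?gt_eqF // add0r.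
by apply: eq_bigr => i _; rewrite coefXM.
Qed.

Lemma psum_conv q A B mu nu m : 0 < q -> supported A mu -> supported B nu ->
  psum q (disc (convolution mu nu) (A + B) m) <=
  2 * 2 `^ q * psum q (disc nu B m * disc mu A m).
Proof.
move=> q0 hA hB; set u := disc nu B m * disc mu A m.
have u0 : nonneg u by apply: nonnegM; exact: disc_ge0.
apply: (@le_trans _ _ (psum q ((1 + 'X) * u))).
  by apply: psum_le => //; [exact: disc_ge0|move=> n; exact: coef_conv].
pose h (k : 'I_2) := if k == ord0 then u else 'X * u.
have -> : (1 + 'X) * u = \sum_k h k.
  by rewrite !big_ord_recl big_ord0 /h /= addr0 mulrDl mul1r.
apply: le_trans (psum_sum q0 _) _.
  move=> k; rewrite /h; case: ifP => // _; apply: nonnegM => // i.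
  by rewrite coefX.
rewrite !big_ord_recl big_ord0 /h /= addr0 psum_mulX //; lra.
Qed.

End Convolution.

(** * Lower limits over the scales *)

Section Scales.
Variable R : realType.

(** The constants are those of [psum_flat] with J the integer part of
    m (1 - eta / 2) and q' the smaller of q and 2; the height k is chosen so that
    k^n exceeds 2^J times the bound on the coefficients of P^n. *)
Lemma one_scale (q eta : R) n N : 1 < q -> 0 < eta -> eta < 1 ->
    (0 < n)%N -> (0 < N)%N ->
  exists K g : R, [/\ 0 < K, 0 < g & forall m (P f : {poly R}),
    nonneg P -> nonneg f -> P.[1] <= 1 -> f.[1] <= 1 ->
    (forall i, (P ^+ n)`_i <= N%:R * (2 ^+ m) `^ (- (1 - eta / 4))) ->
    psum q (P * f) <= K * m.+1%:R `^ (q + 1) *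
      ((2 ^+ m) `^ (- ((1 - eta / 2) * (q - 1))) + (2 ^+ m) `^ (- g) * psum q f)].
Proof.
move=> q1 e0 e1 n0 N0.
have q0 : 0 < q by apply: lt_trans q1.
pose q' := Order.min q 2.
have q'1 : 1 < q' by rewrite lt_min q1 ltr1n.
have q'2 : q' <= 2 by rewrite ge_min lexx orbT.
have q'q : q' <= q by rewrite ge_min lexx.
have nR : 0 < n%:R :> R by rewrite ltr0n.
have NR : 0 < N%:R :> R by rewrite ltr0n.
pose g := eta / (4 * n%:R) * (q' - 1).
have g0 : 0 < g by rewrite mulr_gt0 ?subr_gt0 // divr_gt0 // mulr_gt0.
pose K1 := 2 `^ (q - 1) : R.
pose K2 := 2 * 2 `^ q * (2 * N%:R) `^ (q' - 1) : R.
have K10 : 0 < K1 by rewrite powR_gt0.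
have K20 : 0 < K2 by rewrite !mulr_gt0 ?powR_gt0 // mulr_gt0.
exists (K1 + K2), g; split=> //; first exact: addr_gt0.
move=> m P f P0 f0 P1 f1 hP.
set T : R := 2 ^+ m.
have T0 : 0 < T by rewrite exprn_gt0.
have TE : T = 2 `^ m%:R by rewrite powR_mulrn.
have e2 : 0 < 1 - eta / 2 by lra.
pose J := Num.truncn (m%:R * (1 - eta / 2)).
have /andP[J1 J2] : J%:R <= m%:R * (1 - eta / 2) < J.+1%:R.
  by apply: truncn_itv; rewrite mulr_ge0 // ltW.
rewrite -[J.+1%:R]natr1 in J2.
have Jm : (J <= m)%N.
  rewrite -(ler_nat R); apply: le_trans J1 _; rewrite ler_piMr //; lra.
have Tpow (x : R) : T `^ x = 2 `^ (m%:R * x) by rewrite TE -powRrM.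
have JE : 2 ^+ J = 2 `^ J%:R :> R by rewrite powR_mulrn.
have half : 2^-1 ^+ J <= 2 * T `^ (- (1 - eta / 2)) :> R.
  rewrite exprVn JE -powRN Tpow.
  have {2}-> : 2 = 2 `^ 1 :> R by rewrite powRr1.
  rewrite -powRD; last by rewrite pnatr_eq0 implybT.
  by apply: ler_powR; [rewrite ler1n|lra].
pose k := 2 * N%:R * T `^ (- (eta / (4 * n%:R))).
have k0 : 0 < k by rewrite !mulr_gt0 ?powR_gt0.
have mx0 : 0 <= N%:R * T `^ (- (1 - eta / 4)) by rewrite mulr_ge0 ?powR_ge0.
have hk : 2 ^+ J * (N%:R * T `^ (- (1 - eta / 4))) < k ^+ n.
  apply: (@le_lt_trans _ _ (N%:R * T `^ (- (eta / 4)))).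
    rewrite mulrCA ler_pM2l // JE !Tpow -powRD; last by rewrite pnatr_eq0 implybT.
    by apply: ler_powR; [rewrite ler1n|lra].
  rewrite /k exprMn -[X in _ < _ * X]powR_mulrn ?powR_ge0 // -powRrM.
  have -> : - (eta / (4 * n%:R)) * n%:R = - (eta / 4).
    by field; rewrite gt_eqF.
  rewrite ltr_pM2r ?powR_gt0 //.
  have N1 : 1 <= N%:R :> R by rewrite ler1n.
  apply: (@lt_le_trans _ _ (2 * N%:R)); first by lra.
  by apply: ler_eXnr => //; lra.
have := @psum_flat R q q' f P J k _ n q'1 q'2 q'q f0 P0 f1 P1 k0 mx0 hP hk.
move=> /le_trans; apply.
have T1 : (2^-1 ^+ J) `^ (q - 1) <= K1 * T `^ (- ((1 - eta / 2) * (q - 1))).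
  have -> : K1 * T `^ (- ((1 - eta / 2) * (q - 1))) =
      (2 * T `^ (- (1 - eta / 2))) `^ (q - 1).
    by rewrite powRM ?powR_ge0 // -powRrM mulNr.
  by apply: powR_le => //; rewrite ?subr_ge0 ?ltW // exprn_ge0 // invr_ge0.
have T2 : 2 * 2 `^ q * k `^ (q' - 1) = K2 * T `^ (- g).
  rewrite /k powRM ?powR_ge0 ?mulr_ge0 ?ler0n // -powRrM mulNr /K2 /g; ring.
rewrite T2.
set X := T `^ _ in T1 *; set Y := T `^ (- g); set S := psum q f.
have S0 : 0 <= S by exact: psum_ge0.
have X0 : 0 <= X by exact: powR_ge0.
have Y0 : 0 <= Y by exact: powR_ge0.
have m1 : 1 <= m.+1%:R :> R by rewrite ler1n.
have Jm1 : J%:R <= m.+1%:R :> R by rewrite ler_nat ltnW.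
have P1' : J.+1%:R `^ q <= m.+1%:R `^ q :> R.
  by apply: powR_le; [exact: ltW|exact: ler0n|rewrite ler_nat].
have P2 : m.+1%:R `^ (q + 1) = m.+1%:R `^ q * m.+1%:R :> R.
  rewrite powRD; last by rewrite pnatr_eq0 implybT.
  by rewrite powRr1.
have mq := powR_ge0 (m.+1%:R : R) q.
apply: (@le_trans _ _ (m.+1%:R `^ q * (m.+1%:R * ((K1 + K2) * (X + Y * S))))); last first.
  by rewrite P2 le_eqVlt; apply/orP; left; apply/eqP; ring.
apply: ler_pM => //.
  by rewrite addr_ge0 ?powR_ge0 // !mulr_ge0 // ltW.
have YS : 0 <= Y * S by exact: mulr_ge0.
have A1 : K1 * X <= m.+1%:R * (K1 * X) by rewrite ler_peMl // mulr_ge0 // ltW.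
have A2 : J%:R * (K2 * (Y * S)) <= m.+1%:R * (K2 * (Y * S)).
  by rewrite ler_wpM2r // mulr_ge0 // ltW.
have A3 : 0 <= m.+1%:R * (K1 * (Y * S)) by rewrite !mulr_ge0 // ltW.
have A4 : 0 <= m.+1%:R * (K2 * X) by rewrite !mulr_ge0 // ltW.
rewrite -(mulrA K2); set M := m.+1%:R in A1 A2 A3 A4 *; lra.
Qed.

(** Take logarithms and use ln x < x at a small multiple of m + 1. *)
Lemma poly_growth (K c d : R) : 0 < K -> 0 < c -> 0 < d ->
  exists m0, forall m, (m0 <= m)%N -> K * m.+1%:R `^ c <= (2 ^+ m) `^ d.
Proof.
move=> K0 c0 d0.
have l2 : 0 < ln 2 :> R by rewrite ln_gt0 // ltr1n.
pose a := d * ln 2 / (2 * c).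
have a0 : 0 < a by rewrite divr_gt0 ?mulr_gt0.
have [m0 [_ hm0]] := natr_ub ((ln K + d * ln 2 / 2 - c * ln a) / (d * ln 2 / 2)).
exists m0 => m le.
have b0 : 0 < d * ln 2 / 2 by rewrite divr_gt0 // mulr_gt0.
have hm : ln K + d * ln 2 / 2 - c * ln a <= m%:R * (d * ln 2 / 2).
  rewrite -ler_pdivrMr //; apply: le_trans hm0 _; by rewrite ler_nat.
have m1 : 0 < m.+1%:R :> R by rewrite ltr0n.
have p1 : 0 < m.+1%:R `^ c by rewrite powR_gt0.
have p2 : 0 < 2 ^+ m :> R by rewrite exprn_gt0.
rewrite -ler_ln ?posrE ?mulr_gt0 ?powR_gt0 //.
rewrite [ln (K * _)]lnM ?posrE // !ln_powR [ln (2 ^+ m)]lnXn // -[ln 2 *+ m]mulr_natl.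
have := ln_sublinear (mulr_gt0 a0 m1); rewrite [ln (a * _)]lnM ?posrE // => h.
have h' : c * ln m.+1%:R <= c * (a * m.+1%:R - ln a) by rewrite ler_pM2l //; lra.
have e : c * (a * m.+1%:R) = d * ln 2 / 2 * (m%:R + 1).
  by rewrite /a natr1; field; rewrite gt_eqF.
rewrite mulrBr e in h'; move: h' hm.
set x := ln m.+1%:R; set y := ln a; set z := ln 2; set w : R := m%:R; lra.
Qed.

Lemma limn_einfE (u : (\bar R)^nat) : limn_einf u = ereal_sup (range (einfs u)).
Proof. by rewrite limn_einf_lim; apply/cvg_lim => //; exact: cvg_einfs_sup. Qed.

Lemma limn_einf_ge (u : (\bar R)^nat) c m0 :
  (forall m, (m0 <= m)%N -> (c <= u m)%E) -> (c <= limn_einf u)%E.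
Proof.
move=> h; rewrite limn_einfE; apply: (@le_trans _ _ (einfs u m0)).
  by apply: le_ereal_inf_tmp => _ [m /= hm <-]; exact: h.
by apply: ereal_sup_ubound; exists m0.
Qed.

Lemma limn_einf_gt (u : (\bar R)^nat) x : (x < limn_einf u)%E ->
  exists m0, forall m, (m0 <= m)%N -> (x < u m)%E.
Proof.
rewrite limn_einfE => /ereal_sup_gt [_ [m0 _ <-]] h; exists m0 => m le.
by apply: lt_le_trans h _; apply: ereal_inf_lbound; exists m.
Qed.

Lemma log2_rate (S q x : R) m : 0 < S -> 1 < q -> (0 < m)%N ->
  (x <= - log2 S / ((q - 1) * m%:R)) = (S <= (2 ^+ m) `^ (- ((q - 1) * x))).
Proof.
move=> S0 q1 m0.
have l2 : 0 < ln 2 :> R by rewrite ln_gt0 // ltr1n.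
have d0 : 0 < (q - 1) * m%:R by rewrite mulr_gt0 ?subr_gt0 // ltr0n.
have p2 : 0 < 2 ^+ m :> R by rewrite exprn_gt0.
rewrite ler_pdivlMr // lerNr /log2 ler_pdivrMr //.
rewrite -[RHS]ler_ln ?posrE ?powR_gt0 // ln_powR [ln (2 ^+ m)]lnXn // -[ln 2 *+ m]mulr_natl.
by congr (_ <= _); ring.
Qed.

End Scales.

Theorem corollary1p2 (R : realType) (q C alpha eta : R)
    (hq : 1 < q) (hC : 1 <= C) (halpha : 0 < alpha < 1) (heta : 0 < eta < 1) :
  exists2 epsilon : R, 0 < epsilon &
    forall nu : borel_probability R,
      compactly_supported nu -> ahlfors_regular alpha C nu ->
      forall mu : borel_probability R,
        compactly_supported mu -> (lq_dim mu q < (1 - eta)%:E)%E ->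
        (lq_dim mu q + epsilon%:E < lq_dim (convolution mu nu) q)%E.
Proof.
have /andP[a0 a1] := halpha; have /andP[e0 e1] := heta.
have C0 : 0 < C by apply: lt_le_trans hC.
have q0 : 0 < q by apply: lt_trans hq.
have qm1 : 0 < q - 1 by rewrite subr_gt0.
have e4 : 0 < eta / 4 by rewrite divr_gt0.
have e4' : eta / 4 < 1 by lra.
have [n [N [n0 N0 decay]]] := power_decay a0 a1 C0 e4 e4'.
have [K [g [K0 g0 flat]]] := one_scale hq e0 e1 n0 N0.
(* Both terms of one_scale will be 2^(-(q - 1) (D + 3 eps) m) or less: eps is a
   quarter of the smaller gain; one quarter absorbs the liminf error of mu, one
   the polynomial factor, one makes the inequality strict, and one is the
   announced epsilon. *)
pose eps := Order.min (g / (q - 1)) (eta / 2) / 4.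
have eps0 : 0 < eps by rewrite divr_gt0 // lt_min !divr_gt0.
have eg : 4 * eps <= g / (q - 1) by rewrite /eps mulrC divfK // ge_min lexx.
have ee : 4 * eps <= eta / 2 by rewrite /eps mulrC divfK // ge_min lexx orbT.
exists eps => // nu snu ar mu smu dmu.
have [A hA] := compactly_supported_bound smu.
have [B hB] := compactly_supported_bound snu.
pose Smu m := psum q (disc mu A m).
pose Sc m := psum q (disc (convolution mu nu) (A + B) m).
have rate (P : borel_probability R) E : supported E P -> lq_dim P q =
    limn_einf (fun m => (- log2 (psum q (disc P E m)) / ((q - 1) * m%:R))%:E).
  by move=> hE; congr limn_einf; apply/funext => m; rewrite (lq_sum _ hE).
have S_gt0 (P : borel_probability R) E m : supported E P -> 0 < psum q (disc P E m).
  move=> hE; rewrite lt_neqAle psum_ge0 andbT eq_sym.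
  apply/negP => /eqP h0; have := mass_disc m hE.
  rewrite mass_sum big1 => [/eqP|i _]; first by rewrite eq_sym oner_eq0.
  apply/eqP; have : (disc P E m)`_i `^ q == 0.
    rewrite eq_le powR_ge0 andbT -[leRHS]h0 /psum (bigD1 i) //= lerDl.
    by apply: sumr_ge0 => j _; exact: powR_ge0.
  by rewrite powR_eq0 => /andP[].
have S_le1 (P : borel_probability R) E m : supported E P -> psum q (disc P E m) <= 1.
  move=> hE; apply: (@le_trans _ _ (1 `^ (q - 1))); last by rewrite powR1.
  apply: psum_small => //.
  - exact: disc_ge0.
  - by rewrite mass_disc.
  - by move=> i; rewrite -[leRHS](mass_disc m hE) coef_le_mass //; exact: disc_ge0.
rewrite (rate _ _ (supported_conv hA hB)); rewrite (rate _ _ hA) in dmu *.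
set u := (fun m => _%:E) in dmu *; set v := (fun m => _%:E).
have dge0 : (0%:E <= limn_einf u)%E.
  apply: (@limn_einf_ge _ _ _ 1) => m m0; rewrite lee_fin.
  by rewrite log2_rate ?S_gt0 // mulr0 oppr0 powRr0 S_le1.
have [D dE] : exists D : R, limn_einf u = D%:E.
  by move: dmu dge0; case: (limn_einf u) => // r _ _; exists r.
rewrite dE in dmu dge0 *; rewrite lte_fin in dmu; rewrite lee_fin in dge0.
have [m1 hm1] : exists m1, forall m, (m1 <= m)%N -> ((D - eps)%:E < u m)%E.
  by apply: limn_einf_gt; rewrite dE lte_fin ltrBlDr ltrDl.
pose K' := 2 * 2 `^ q * K * 2 : R.
have K'0 : 0 < K' by rewrite !mulr_gt0 ?powR_gt0.
have [m2 hm2] := @poly_growth R K' (q + 1) ((q - 1) * eps) K'0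
  (addr_gt0 q0 ltr01) (mulr_gt0 qm1 eps0).
apply: (@lt_le_trans _ _ (D + 2 * eps)%:E); first by rewrite lte_fin; lra.
apply: (@limn_einf_ge _ _ _ (maxn 1 (maxn m1 m2))) => m.
rewrite !geq_max => /and3P[m0 le1 le2].
rewrite /v lee_fin log2_rate ?S_gt0 //; last exact: supported_conv.
have := hm1 m le1; rewrite /u lte_fin => /ltW.
rewrite log2_rate ?S_gt0 // => hS.
apply: le_trans (psum_conv m q0 hA hB) _.
have hf := flat m (disc nu B m) (disc mu A m) (disc_ge0 _ _ _) (disc_ge0 _ _ _).
rewrite !mass_disc // in hf.
have reg := regular_disc m hB C0 ar.
have := decay m _ reg; rewrite mass_disc // => /(_ (lexx _)) hdec.
have {hf} hf := hf (lexx _) (lexx _) hdec.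
set T : R := 2 ^+ m in hS hf *.
have T1 : 1 <= T by rewrite exprn_ege1 // ler1n.
have T0 : 0 < T by apply: lt_le_trans T1.
have Tn (x : R) : (x == 0) ==> (T != 0) by rewrite (gt_eqF T0) implybT.
pose Z := T `^ (- ((q - 1) * (D + 3 * eps))).
have Z1 : T `^ (- ((1 - eta / 2) * (q - 1))) <= Z.
  apply: ler_powR => //; rewrite lerN2 mulrC ler_pM2r //; lra.
have Z2 : T `^ (- g) * psum q (disc mu A m) <= Z.
  apply: (@le_trans _ _ (T `^ (- g) * T `^ (- ((q - 1) * (D - eps))))).
    by rewrite ler_wpM2l ?powR_ge0.
  rewrite -powRD //; apply: ler_powR => //.
  rewrite ler_pdivlMr // in eg; lra.
apply: (@le_trans _ _ (2 * 2 `^ q * (K * m.+1%:R `^ (q + 1)) * (2 * Z))).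
  rewrite -[leRHS]mulrA; apply: ler_wpM2l; first by rewrite mulr_ge0 ?powR_ge0.
  apply: le_trans hf _; apply: ler_wpM2l; first by rewrite mulr_ge0 ?powR_ge0 // ltW.
  by lra.
have := hm2 m le2; rewrite -/T => h3.
apply: (@le_trans _ _ (T `^ ((q - 1) * eps) * Z)).
  have Z0 : 0 <= Z by exact: powR_ge0.
  have := ler_wpM2r Z0 h3; rewrite /K'; lra.
rewrite -powRD //; apply: ler_powR => //; lra.
Qed.
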